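(* Let $\mathcal{F}$ be a one-dimensional holomorphic foliation on $\mathbb{P}_{\mathbb{C}}^n$ of degree $d\geq 2$ and let $\mathscr{N}(d,k)$ be the number of hypersurfaces of degree $k$ invariant by $\mathcal{F}$. Suppose that $\mathscr{N}(d,k)>\binom{n+k}{k}$ and that there exists a hypersurface of degree $k$ invariant by $\mathcal{F}$ such that $$k>\frac{(d-1)\cdot\binom{\binom{n+k}{k}}{2}}{\mathscr{N}(d,k)-\binom{n+k}{k}}.$$ Then $\mathcal{F}$ admits a rational first integral.
   Context: A one-dimensional holomorphic foliation $\mathcal{F}$ on $\mathbb{P}^n_{\mathbb{C}}$ is given by an open cover $\{U_\alpha\}$, holomorphic vector fields $\vartheta_\alpha$ on $U_\alpha$ (not identically zero) and $g_{\alpha\beta}\in\mathscr{O}^*(U_\alpha\cap U_\beta)$ with $\vartheta_\alpha=g_{\alpha\beta}\vartheta_\beta$; $T_{\mathcal{F}}^*$ is the line bundle with cocycle $\{g_{\alpha\beta}\}$. The foliation has degree $d$ when $T_{\mathcal{F}}^*\cong\mathcal{O}_{\mathbb{P}^n}(d-1)$ (equivalently, $d$ is the degree of the tangency locus of $\mathcal{F}$ with a generic hyperplane). A hypersurface with local equations $f_\alpha=0$ is invariant by $\mathcal{F}$ if $\vartheta_\alpha(f_\alpha)$ vanishes identically on it, i.e. lies in the ideal generated by $f_\alpha$, for every $\alpha$. A rational first integral for $\mathcal{F}$ is a nonconstant rational map $\Theta:\mathbb{P}^n_{\mathbb{C}}\dashrightarrow Y$, with $Y$ an algebraic variety, whose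 fibers are $\mathcal{F}$-invariant.
   Formalization: Hypersurfaces of degree k are taken irreducible, both in the count N(d,k) and in the existence hypothesis; counting reducible ones makes the claim false (e.g. 36 pairs of the 9 invariant lines of a generic p(x)∂x+q(y)∂y of degree 4 on the plane, k=2). *)

(* Defs.v *)
From HB Require Import structures.
From mathcomp Require Import all_boot all_order all_algebra.
From mathcomp Require Import all_classical all_reals all_analysis.
From mathcomp Require Import complex.
(* The notations of mpoly clash with those of analysis. *)
From mathcomp Require Import -(notations) mpoly.

Set Implicit Arguments.
Unset Strict Implicit.
Unset Printing Implicit Defensive.

Import Order.TTheory GRing.Theory Num.Theory numFieldNormedType.Exports.
Local Open Scope ring_scope.
Local Open Scope classical_set_scope.

(* Ascribing R[i] this type makes Cx R and 'rV[Cx R]_n complex normed modules,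
   so that [differentiable] and ['d] below are complex-linear notions. *)
Definition Cx (R : realType) : numClosedFieldType := R[i].

Section ProjectiveSpace.
Variables (R : realType) (n : nat).
Local Notation C := (Cx R).

Definition proj_space : Type :=
  {L : {vspace 'rV[C]_n.+1} | \dim L == 1%N}.

(* A choice of homogeneous coordinates; only expressions of degree 0 in
   [hcoord p], or their vanishing, are used below. *)
Definition hcoord (p : proj_space) : 'rV[C]_n.+1 := vpick (sval p).

Definition insert1 (j : 'I_n.+1) (z : 'rV[C]_n) : 'rV[C]_n.+1 :=
  \row_i oapp (fun k => z 0 k) 1 (unlift j i).

Lemma insert1_dim j z : \dim <[insert1 j z]>%VS == 1%N.
Proof.
rewrite dim_vline eqb1; apply/eqP => /rowP /(_ j).
by rewrite !mxE unlift_none /= => /eqP; rewrite oner_eq0.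
Qed.

(* The j-th affine parametrization C^n -> P^n: insert 1 at position j. *)
Definition pchart (j : 'I_n.+1) (z : 'rV[C]_n) : proj_space :=
  exist _ <[insert1 j z]>%VS (insert1_dim j z).

Definition affine (j : 'I_n.+1) : set proj_space :=
  [set p | hcoord p 0 j != 0].

Definition aff_coord (j : 'I_n.+1) (p : proj_space) : 'rV[C]_n :=
  \row_k (hcoord p 0 (lift j k) / hcoord p 0 j).

Lemma hcoord_pchart j z :
  exists2 c : C, c != 0 & hcoord (pchart j z) = c *: insert1 j z.
Proof.
have /vlineP[c hc] := memv_pick (<[insert1 j z]>%VS).
exists c; last by rewrite /hcoord /= hc.
apply: contraTneq (insert1_dim j z) => c0.
have : vpick <[insert1 j z]>%VS == 0 by rewrite hc c0 scale0r.
by rewrite vpick0 => /eqP ->; rewrite dimv0.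
Qed.

Lemma affine_pchart j z : affine j (pchart j z).
Proof.
have [c c0 h] := hcoord_pchart j z.
by rewrite /affine /= h !mxE unlift_none /= mulr1.
Qed.

Lemma pchartK j : cancel (pchart j) (aff_coord j).
Proof.
move=> z; have [c c0 h] := hcoord_pchart j z.
apply/rowP => k; rewrite !mxE h !mxE liftK unlift_none /=.
by rewrite mulr1 mulrAC divff ?mul1r.
Qed.

Definition popen (U : set proj_space) : Prop :=
  forall j, open (pchart j @^-1` U).

Definition holomorphic (U : set proj_space) (f : proj_space -> C) : Prop :=
  forall j z, U (pchart j z) -> differentiable (f \o pchart j) z.

(* [v j] is the expression of the field in the affine coordinates number j;
   only its values on the preimage of the domain of the field matter. *)
Definition vfield : Type := 'I_n.+1 -> 'rV[C]_n -> 'rV[C]_n.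

Definition holomorphic_vfield (U : set proj_space) (v : vfield) : Prop :=
  (forall j z, U (pchart j z) -> differentiable (v j) z) /\
  (forall i j z, (U `&` affine j) (pchart i z) ->
     v j (aff_coord j (pchart i z)) = 'd (aff_coord j \o pchart i) z (v i z)).

(* v(f) at the point [pchart j z]. *)
Definition vderiv (v : vfield) (f : proj_space -> C) j (z : 'rV[C]_n) : C :=
  'd (f \o pchart j) z (v j z).

(* Transition functions are read as s_a = g_ab s_b on local sections. *)
Record cocycle : Type := Cocycle {
  lb_index : Type;
  lb_cover : lb_index -> set proj_space;
  lb_trans : lb_index -> lb_index -> proj_space -> C }.

(* [lam a i] is the local expression, on the overlap of a member of each cover,
   of an isomorphism L -> M: sections correspond by s'_i = lam_ai s_a. *)
Definition lb_iso (L M : cocycle) : Prop :=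
  exists lam : lb_index L -> lb_index M -> proj_space -> C,
    (forall a i, holomorphic (lb_cover a `&` lb_cover i) (lam a i) /\
       forall p, (lb_cover a `&` lb_cover i) p -> lam a i p != 0) /\
    (forall a b i j p,
       lb_cover a p -> lb_cover b p -> lb_cover i p -> lb_cover j p ->
       lb_trans i j p * lam b j p = lam a i p * lb_trans a b p).

(* O(m): a form P of degree m has the local sections P / x_i^m, whence the
   transition functions (x_j / x_i)^m. *)
Definition twist (m : int) : cocycle :=
  @Cocycle 'I_n.+1 affine (fun i j p => (hcoord p 0 j / hcoord p 0 i) ^ m).

Record foliation : Type := Foliation {
  fol_index : Type;
  fol_cover : fol_index -> set proj_space;
  fol_field : fol_index -> vfield;
  fol_trans : fol_index -> fol_index -> proj_space -> C;
  fol_open : forall a, popen (fol_cover a);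
  fol_covers : forall p, exists a, fol_cover a p;
  fol_hol : forall a, holomorphic_vfield (fol_cover a) (fol_field a);
  fol_neq0 : forall a,
    exists j z, fol_cover a (pchart j z) /\ fol_field a j z != 0;
  fol_trans_hol : forall a b,
    holomorphic (fol_cover a `&` fol_cover b) (fol_trans a b);
  fol_trans_neq0 : forall a b p,
    (fol_cover a `&` fol_cover b) p -> fol_trans a b p != 0;
  fol_glue : forall a b j z, (fol_cover a `&` fol_cover b) (pchart j z) ->
    fol_field a j z = fol_trans a b (pchart j z) *: fol_field b j z }.

Definition cotangent (F : foliation) : cocycle :=
  @Cocycle (fol_index F) (@fol_cover F) (@fol_trans F).

Definition fol_degree (F : foliation) (d : nat) : Prop :=
  lb_iso (cotangent F) (twist (d%:Z - 1)).

(* The locus {f_i = 0, i : I} in the open set W is invariant when each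
   theta_a (f_i) lies in the ideal generated by the f_l. *)
Definition invariant_locus (F : foliation) (W : set proj_space) (I : finType)
    (f : I -> proj_space -> C) : Prop :=
  forall (a : fol_index F) (i : I), exists h : I -> proj_space -> C,
    (forall l, holomorphic (fol_cover a `&` W) (h l)) /\
    (forall j z, (fol_cover a `&` W) (pchart j z) ->
       vderiv (fol_field a) (f i) j z =
       \sum_l h l (pchart j z) * f l (pchart j z)).

Definition form_at (f : mpoly n.+1 C) (p : proj_space) : C :=
  meval (fun i => hcoord p 0 i) f.

Definition is_form (k : nat) (f : mpoly n.+1 C) : bool :=
  f \is ishomog1 k mdeg.

Definition zeros (f : mpoly n.+1 C) : set proj_space :=
  [set p | form_at f p = 0].

(* Nonempty and irreducible Zariski closed subset of P^n. *)
Definition zariski_closed (Y : set proj_space) : Prop :=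
  exists S : set (mpoly n.+1 C),
    (forall f, S f -> exists e, is_form e f) /\
    Y = [set p | forall f, S f -> zeros f p].

Definition projective_variety (Y : set proj_space) : Prop :=
  [/\ zariski_closed Y, Y !=set0 &
    forall A B, zariski_closed A -> zariski_closed B ->
      Y `<=` A `|` B -> Y `<=` A \/ Y `<=` B].

End ProjectiveSpace.

Definition irreducible_elt (A : idomainType) (f : A) : Prop :=
  [/\ f != 0, f \isn't a GRing.unit &
    forall a b, f = a * b -> a \is a GRing.unit \/ b \is a GRing.unit].

Section Invariance.
Variables (R : realType) (n : nat).
Local Notation C := (Cx R).
Variable F : foliation R n.

(* Hypersurfaces of degree k are prime divisors: zero sets of irreducible forms
   of degree k. In the affine open set x_j <> 0 the local equation is
   f / x_j^k. *)
Definition invariant_hypersurfaces (k : nat) : set (set (proj_space R n)) :=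
  [set H | exists f : mpoly n.+1 C,
    [/\ is_form k f, irreducible_elt f, H = zeros f &
      forall j, invariant_locus F (affine j)
        (fun (_ : 'I_1) p => form_at f p / hcoord p 0 j ^+ k)]].

(* [counting] gives +oo when there are infinitely many. *)
Definition num_invariant (k : nat) : \bar R :=
  counting (invariant_hypersurfaces k).

Definition rmap_row (m : nat) (T : 'I_m.+1 -> mpoly n.+1 C)
    (p : proj_space R n) : 'rV[C]_m.+1 :=
  \row_i form_at (T i) p.

(* The rational map [T_0 : ... : T_m] is defined at p with value y; in
   particular the T_i do not all vanish at p, since [sval y] is a line. *)
Definition rmap_value (m : nat) (T : 'I_m.+1 -> mpoly n.+1 C)
    (p : proj_space R n) (y : proj_space R m) : Prop :=
  sval y = <[rmap_row T p]>%VS.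

(* The fiber over a point y with y_l <> 0 lies in the open set T_l <> 0, where
   its local equations are T_i / T_l = y_i / y_l. *)
Definition invariant_fiber (m : nat) (T : 'I_m.+1 -> mpoly n.+1 C)
    (y : proj_space R m) : Prop :=
  forall l, affine l y ->
    invariant_locus F [set p | rmap_row T p 0 l != 0]
      (fun (i : 'I_m.+1) p =>
         rmap_row T p 0 i / rmap_row T p 0 l - hcoord y 0 i / hcoord y 0 l).

Definition has_rational_first_integral : Prop :=
  exists (m : nat) (Y : set (proj_space R m)) (e : nat)
         (T : 'I_m.+1 -> mpoly n.+1 C),
    [/\ projective_variety Y,
        forall i, is_form e (T i),
        forall p y, rmap_value T p y -> Y y,
        exists p q y y', [/\ rmap_value T p y, rmap_value T q y' & y <> y'] &
        forall y, Y y -> invariant_fiber T y].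

End Invariance.

(* Main.v *)
(* The argument is that of the extactic divisor. A foliation of degree d on P^n
   is induced by a homogeneous polynomial vector field X of degree d on
   C^(n+1). Let M = 'C(n+k, k) and let E be the Wronskian, with respect to X,
   of the M monomials of degree k: it is a form of degree k M + (d-1) 'C(M, 2).
   An invariant form f of degree k satisfies X f = h f, hence all X^a f are
   multiples of f; as they form a linear combination of the columns of the
   Wronskian matrix, f divides E. So if E <> 0, the N irreducible invariant
   forms, which are pairwise coprime, give k N <= k M + (d-1) 'C(M, 2), against
   the hypothesis. Hence E = 0, and Cramer's rule on the first singular
   Wronskian expresses a monomial in terms of earlier ones with coefficients
   P_b / Q which X annihilates; these are quotients of forms of the same degree,
   and they are not all constant.

   That X is polynomial comes from Liouville's theorem: the bivector X /\ Euler
   is determined by the foliation, is homogeneous on C^(n+1) and holomorphic off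
   the origin, so its coefficients are polynomial on every line. *)
Require Import Defs.
From HB Require Import structures.
From mathcomp Require Import all_boot all_order all_algebra.
From mathcomp Require Import all_classical all_reals all_analysis.
From mathcomp Require Import complex.
From mathcomp Require Import ring lra zify.
From mathcomp Require Import -(notations) finmap.
From mathcomp Require Import -(notations) mpoly.

Set Implicit Arguments.
Unset Strict Implicit.
Unset Printing Implicit Defensive.

Import Order.TTheory GRing.Theory Num.Theory numFieldNormedType.Exports.
Local Open Scope ring_scope.
Local Open Scope classical_set_scope.

(** * Bisection and the Goursat lemma *)

Section Bisection.
Variable R : realType.
Implicit Types (a b w h x y : R).

(** Invariance supplies in each chart a holomorphic cofactor, not a polynomial one. Evaluated at the
    zeros of f it shows that X f vanishes there; divisibility of X f by f is then recovered
    algebraically, from factoriality of the polynomial ring and a Nullstellensatz for one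
    irreducible form. Holomorphic means complex differentiable at each point, with no continuity
    assumed of the derivative, so Liouville's theorem rests on Goursat's bisection. Polynomials,
    rather than constants, are reached by lowering the growth through difference quotients; these
    are only known to be continuous at their base points, whence the finite exceptional sets.
    Independence of circle means from the radius, compared at small and large radii, takes the place
    of Cauchy's formula. The foliation determines X only up to multiples of the Euler field. This is
    why the bivector, which does not see such multiples, is built first, and why exactness of a
    Koszul complex is needed to choose one X. *)

Lemma bisection_step (Pr : R -> R -> R -> R -> Prop) a b w h :
  (forall a b w h,
     Pr a b (w / 2) (h / 2) -> Pr (a + w / 2) b (w / 2) (h / 2) ->
     Pr a (b + h / 2) (w / 2) (h / 2) ->
     Pr (a + w / 2) (b + h / 2) (w / 2) (h / 2) -> Pr a b w h) ->
  ~ Pr a b w h ->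
  exists p : R * R, [/\ p.1 = a \/ p.1 = a + w / 2,
    p.2 = b \/ p.2 = b + h / 2 & ~ Pr p.1 p.2 (w / 2) (h / 2)].
Proof.
move=> split nP; apply: contrapT => np; apply: nP.
have aux p1 p2 : (p1 = a \/ p1 = a + w / 2) -> (p2 = b \/ p2 = b + h / 2) ->
  Pr p1 p2 (w / 2) (h / 2).
  by move=> h1 h2; apply: contrapT => n; apply: np; exists (p1, p2).
by apply: split; apply: aux; auto.
Qed.

Lemma nested_intervals (u : nat -> R) w : 0 <= w ->
  (forall n, u n.+1 = u n \/ u n.+1 = u n + w / 2 ^+ n.+1) ->
  exists x, forall n, u n <= x <= u n + w / 2 ^+ n.
Proof.
move=> w0 hu.
have wS n : w / 2 ^+ n = w / 2 ^+ n.+1 + w / 2 ^+ n.+1.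
  by rewrite exprSr invfM mulrA -splitr.
have wp n : 0 <= w / 2 ^+ n by rewrite divr_ge0 ?exprn_ge0.
have step n : u n <= u n.+1 /\ u n.+1 + w / 2 ^+ n.+1 <= u n + w / 2 ^+ n.
  have := wp n.+1; have := wS n; case: (hu n) => -> ; lra.
have mono m n : (m <= n)%N ->
    u m <= u n /\ u n + w / 2 ^+ n <= u m + w / 2 ^+ m.
  elim: n => [|n IH]; first by rewrite leqn0 => /eqP ->.
  rewrite leq_eqVlt => /predU1P[->//|/IH[h1 h2]].
  by have [h3 h4] := step n; split; [apply: le_trans h3|apply: le_trans h2].
have ub m n : u m <= u n + w / 2 ^+ n.
  have [/mono[h1 _]|/ltnW/mono[_]] := leqP m n; have := wp m; have := wp n; lra.
have hs : has_sup (range u).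
  by split; [exists (u 0%N); exists 0%N|exists (u 0%N + w / 2 ^+ 0) => _ [m _ <-]].
exists (sup (range u)) => n; apply/andP; split.
  by apply: ub_le_sup; [case: hs|exists n].
by apply: ge_sup; [case: hs|move=> _ [m _ <-]].
Qed.

(** If the property failed, it would fail on a nested sequence of quarters, whose common point
    contradicts local validity. It serves both for Goursat's estimate and for uniform continuity
    along a circle. *)
Lemma rectangle_bisection (Pr : R -> R -> R -> R -> Prop) a b w h :
  0 <= w -> 0 <= h ->
  (forall a b w h,
     Pr a b (w / 2) (h / 2) -> Pr (a + w / 2) b (w / 2) (h / 2) ->
     Pr a (b + h / 2) (w / 2) (h / 2) ->
     Pr (a + w / 2) (b + h / 2) (w / 2) (h / 2) -> Pr a b w h) ->
  (forall x y, a <= x <= a + w -> b <= y <= b + h ->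
     exists2 e, 0 < e & forall a' b' n,
       a' <= x <= a' + w / 2 ^+ n -> b' <= y <= b' + h / 2 ^+ n ->
       w / 2 ^+ n < e -> h / 2 ^+ n < e -> Pr a' b' (w / 2 ^+ n) (h / 2 ^+ n)) ->
  Pr a b w h.
Proof.
move=> w0 h0 split loc; apply: contrapT => nP.
pose bad n (p : R * R) := ~ Pr p.1 p.2 (w / 2 ^+ n) (h / 2 ^+ n).
have half (z : R) n : z / 2 ^+ n.+1 = z / 2 ^+ n / 2.
  by rewrite exprSr invfM mulrA.
(* The implication under the existential makes the choice function total: it returns a bad quarter
   whenever its argument is bad. *)
have /choice[f hf] : forall q : nat * (R * R), exists p : R * R, bad q.1 q.2 ->
    [/\ p.1 = q.2.1 \/ p.1 = q.2.1 + w / 2 ^+ q.1.+1,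
        p.2 = q.2.2 \/ p.2 = q.2.2 + h / 2 ^+ q.1.+1 & bad q.1.+1 p].
  move=> [n p] /=; have [bp|nb] := pselect (bad n p); last by exists p.
  have [p' [h1 h2 h3]] := bisection_step split bp.
  by exists p'; rewrite /bad !half.
pose s := fix s n := if n is m.+1 then f (m, s m) else (a, b).
have sbad n : bad n (s n).
  by elim: n => [|n IH]; rewrite /bad /= ?expr0 ?divr1 //; case: (hf (n, s n) IH).
have [|x hx] := @nested_intervals (fun n => (s n).1) w w0.
  by move=> n; case: (hf (n, s n) (sbad n)).
have [|y hy] := @nested_intervals (fun n => (s n).2) h h0.
  by move=> n; case: (hf (n, s n) (sbad n)).
have [||e e0 he] := loc x y.
- by have := hx 0%N; rewrite expr0 divr1.
- by have := hy 0%N; rewrite expr0 divr1.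
have [n hn] : exists n, w / 2 ^+ n < e /\ h / 2 ^+ n < e.
  pose N := Num.truncn ((w + h) / e).
  have hN : (w + h) / e < 2 ^+ N.+1.
    have := @truncnS_gt _ ((w + h) / e); move=> /lt_le_trans; apply.
    by rewrite -natrX ler_nat ltnW // ltn_expl.
  exists N.+1; rewrite !ltr_pdivrMr ?exprn_gt0 //.
  move: hN; rewrite ltr_pdivrMr // mulrC => hN.
  by split; apply: le_lt_trans hN; lra.
by apply: (sbad n); apply: he (hx n) (hy n) _ _; case: hn.
Qed.

End Bisection.

Section Goursat.
Variable R : realType.

(** The mean value theorem for [G - H]. This is the usual length times maximum estimate for an
    integral over a side, with the integral replaced by the increment of a primitive. *)
Lemma primitive_approx (G H g k : R -> R) (a w e : R) : 0 <= w ->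
  (forall s, a <= s <= a + w -> is_derive s 1 G (g s)) ->
  (forall s, a <= s <= a + w -> is_derive s 1 H (k s)) ->
  (forall s, a <= s <= a + w -> `|g s - k s| <= e) ->
  `|(G (a + w) - G a) - (H (a + w) - H a)| <= e * w.
Proof.
move=> w0 hG hH hgk; have aw : a <= a + w by lra.
have D s : a <= s <= a + w -> is_derive s 1 (G - H) (g s - k s).
  by move=> /[dup] /hG ? /hH ?; exact: is_deriveB.
have [||c] := @MVT_segment R (G - H) (fun s => g s - k s) _ _ aw.
- by move=> x; rewrite in_itv /= => /andP[/ltW h1 /ltW h2]; apply: D; rewrite h1.
- apply: derivable_within_continuous => x; rewrite in_itv /= => xaw.
  by have [] := D x xaw.
rewrite in_itv /= => caw; rewrite !fctE => E.
rewrite [X in `|X|](_ : _ = (g c - k c) * w); last by lra.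
by rewrite normrM (ger0_norm w0) ler_wpM2r // hgk.
Qed.

(** Primitive, along one side, of a first-order expansion at a point of abscissa [x]; [c2] is the
    contribution of the other coordinate, which is frozen on the side. *)
Lemma is_derive_affine (c0 c1 c2 x s : R) :
  is_derive s 1 (fun s => c0 * s + c1 * (s - x) ^+ 2 / 2 + c2 * s)
    (c0 + c1 * (s - x) + c2).
Proof.
have -> : (fun s => c0 * s + c1 * (s - x) ^+ 2 / 2 + c2 * s) =
    (c0 *: id) + ((c1 / 2) *: (id - cst x) ^+ 2) + (c2 *: id).
  by apply/funext => y; rewrite !fctE /= /GRing.scale /=; ring.
have Did : is_derive s 1 (id : R -> R) 1 := is_derive_id _ _.
have D2 := is_deriveX 2 (is_deriveB Did (is_derive_cst x s 1)).
have := is_deriveD (is_deriveD (is_deriveZ c0 Did) (is_deriveZ (c1 / 2) D2))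
  (is_deriveZ c2 Did).
move=> /is_derive_eq; apply.
by rewrite /GRing.scale /= !fctE /=; field.
Qed.

(** The counterclockwise circulation of P ds + Q dt around the rectangle, where [GP] and [GQ] are
    primitives of P in s and of Q in t. *)
Definition boundary_sum (GP GQ : R -> R -> R) (a b w h : R) :=
  GP (a + w) b - GP a b - (GP (a + w) (b + h) - GP a (b + h)) +
  (GQ (a + w) (b + h) - GQ (a + w) b) - (GQ a (b + h) - GQ a b).

(* The hypothesis says that P ds + Q dt is differentiable at each point, with
   symmetric Jacobian; its partial derivatives need not be continuous. *)
Lemma goursat (P Q GP GQ : R -> R -> R) (a b w h : R) : 0 <= w -> 0 <= h ->
  (forall s t, a <= s <= a + w -> b <= t <= b + h ->
    is_derive s 1 (GP^~ t) (P s t)) ->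
  (forall s t, a <= s <= a + w -> b <= t <= b + h ->
    is_derive t 1 (GQ s) (Q s t)) ->
  (forall s t, a <= s <= a + w -> b <= t <= b + h ->
    exists p1 p2 q2 : R, forall e : R, 0 < e -> exists2 d : R, 0 < d & forall s' t',
      `|s' - s| < d -> `|t' - t| < d ->
      `|P s' t' - (P s t + p1 * (s' - s) + p2 * (t' - t))|
         <= e * (`|s' - s| + `|t' - t|) /\
      `|Q s' t' - (Q s t + p2 * (s' - s) + q2 * (t' - t))|
         <= e * (`|s' - s| + `|t' - t|)) ->
  boundary_sum GP GQ a b w h = 0.
Proof.
move=> w0 h0 hGP hGQ hd.
suff main (e : R) : 0 < e -> `|boundary_sum GP GQ a b w h| <= e * (w + h) ^+ 2.
  apply/eqP; rewrite -normr_le0; apply/ler_addgt0Pr => e e0; rewrite add0r.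
  have c0 : 0 < (w + h) ^+ 2 + 1 by have := sqr_ge0 (w + h); lra.
  apply: le_trans (main (e / ((w + h) ^+ 2 + 1)) _) _; first by rewrite divr_gt0.
  rewrite mulrAC ler_pdivrMr // ler_wpM2l //; lra.
move=> e0.
(* The bound is homogeneous of degree 2 in the sides, so the bounds of the four quarters add up to
   exactly that of the whole. *)
pose Pr (a' b' w' h' : R) := 0 <= w' -> 0 <= h' -> a <= a' -> a' + w' <= a + w ->
  b <= b' -> b' + h' <= b + h ->
  `|boundary_sum GP GQ a' b' w' h'| <= e * (w' + h') ^+ 2.
suff : Pr a b w h by apply.
apply: rectangle_bisection => // [{}a' {}b' w' h' H1 H2 H3 H4 w'0 h'0 i1 i2 i3 i4|].
  rewrite (_ : boundary_sum _ _ _ _ _ _ =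
    boundary_sum GP GQ a' b' (w' / 2) (h' / 2) +
    boundary_sum GP GQ (a' + w' / 2) b' (w' / 2) (h' / 2) +
    (boundary_sum GP GQ a' (b' + h' / 2) (w' / 2) (h' / 2) +
    boundary_sum GP GQ (a' + w' / 2) (b' + h' / 2) (w' / 2) (h' / 2))); last first.
    rewrite /boundary_sum -[a' + w' / 2 + _]addrA -splitr.
    by rewrite -[b' + h' / 2 + _]addrA -splitr; ring.
  rewrite (_ : e * _ = e * (w' / 2 + h' / 2) ^+ 2 + e * (w' / 2 + h' / 2) ^+ 2 +
     (e * (w' / 2 + h' / 2) ^+ 2 + e * (w' / 2 + h' / 2) ^+ 2)); last by field.
  have {}H1 := H1 ltac:(lra) ltac:(lra) ltac:(lra) ltac:(lra) ltac:(lra) ltac:(lra).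
  have {}H2 := H2 ltac:(lra) ltac:(lra) ltac:(lra) ltac:(lra) ltac:(lra) ltac:(lra).
  have {}H3 := H3 ltac:(lra) ltac:(lra) ltac:(lra) ltac:(lra) ltac:(lra) ltac:(lra).
  have {}H4 := H4 ltac:(lra) ltac:(lra) ltac:(lra) ltac:(lra) ltac:(lra) ltac:(lra).
  by do 2![apply: le_trans (ler_normD _ _) _; apply: lerD => //].
move=> x y hx hy.
have [p1 [p2 [q2 hd']]] := hd x y hx hy.
have [d d0 {}hd] := hd' (e / 2) ltac:(lra).
exists d => // a' b' n; set w' := w / _; set h' := h / _.
move=> hx' hy' wd h'd w'0 h'0 i1 i2 i3 i4.
have inw s : a' <= s <= a' + w' -> a <= s <= a + w /\ `|s - x| <= w'.
  by move=> hs; rewrite ler_norml; lra.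
have inh t : b' <= t <= b' + h' -> b <= t <= b + h /\ `|t - y| <= h'.
  by move=> hs; rewrite ler_norml; lra.
have E s t : a' <= s <= a' + w' -> b' <= t <= b' + h' ->
   `|P s t - (P x y + p1 * (s - x) + p2 * (t - y))| <= e / 2 * (w' + h') /\
   `|Q s t - (Q x y + q2 * (t - y) + p2 * (s - x))| <= e / 2 * (w' + h').
  move=> /inw[h1 h2] /inh[h3 h4].
  have [||k1 k2] := hd s t; try exact: le_lt_trans h2 _;
    try exact: le_lt_trans h4 _.
  split; first by apply: le_trans k1 _; apply: ler_wpM2l; [lra|exact: (lerD h2 h4)].
  by rewrite addrAC; apply: le_trans k2 _; apply: ler_wpM2l;
    [lra|exact: (lerD h2 h4)].
have PA t : b' <= t <= b' + h' -> _ := fun ht =>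
  @primitive_approx (GP^~ t) _ (P^~ t) _ a' w' (e / 2 * (w' + h')) w'0
    (fun s hs => hGP s t (inw s hs).1 (inh t ht).1)
    (fun s hs => is_derive_affine (P x y) p1 (p2 * (t - y)) x s)
    (fun s hs => (E s t hs ht).1).
have QA s : a' <= s <= a' + w' -> _ := fun hs =>
  @primitive_approx (GQ s) _ (Q s) _ b' h' (e / 2 * (w' + h')) h'0
    (fun t ht => hGQ s t (inw s hs).1 (inh t ht).1)
    (fun t ht => is_derive_affine (Q x y) q2 (p2 * (s - x)) y t)
    (fun t ht => (E s t hs ht).2).
(* The affine parts contribute - p2 w' h' on the horizontal sides and p2 w' h' on the vertical ones:
   they cancel because P and Q share the coefficient [p2]. Only the four error terms remain. *)
have P1 := PA b' ltac:(lra); have P2 := PA (b' + h') ltac:(lra).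
have Q1 := QA a' ltac:(lra); have Q2 := QA (a' + w') ltac:(lra).
have {PA QA E hd hd' hGP hGQ} := (P1, P2, Q1, Q2).
rewrite /boundary_sum.
rewrite (_ : e * (w' + h') ^+ 2 = (e / 2 * (w' + h') * w') + (e / 2 * (w' + h') *
  w')
  + (e / 2 * (w' + h') * h' + e / 2 * (w' + h') * h')); last by field.
move: (e / 2 * (w' + h') * w') (e / 2 * (w' + h') * h') => K1 K2.
rewrite !ler_norml => -[[[/andP[A1 A2] /andP[A3 A4]] /andP[A5 A6]] /andP[A7 A8]].
by apply/andP; split; lra.
Qed.

End Goursat.

(** * Circle means of complex differentiable functions *)

Section Modulus.
Variable R : realType.
Local Notation C := (Cx R).
Local Notation Re := complex.Re.
Local Notation Im := complex.Im.
Implicit Types z w : C.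

(** The norm of [Cx R] takes values in [Cx R]; this copy of it lies in R, where the estimates are
    made. *)
Definition cmod z : R := Re `|z|.
Local Notation toC := (real_complex R).

Lemma cmodE z : `|z| = toC (cmod z).
Proof. by rewrite [RHS]RRe_real // normr_real. Qed.

Lemma cmod_lt z (e : R) : (`|z| < toC e) = (cmod z < e).
Proof. by rewrite cmodE ltcR. Qed.

Lemma cmod_le z (e : R) : (`|z| <= toC e) = (cmod z <= e).
Proof. by rewrite cmodE lecR. Qed.

Lemma cmod_ge0 z : 0 <= cmod z.
Proof. by rewrite -lecR -cmodE rmorph0 normr_ge0. Qed.

Lemma cmodM z w : cmod (z * w) = cmod z * cmod w.
Proof. by apply: complexI; rewrite rmorphM /= -!cmodE normrM. Qed.

Lemma cmodD z w : cmod (z + w) <= cmod z + cmod w.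
Proof. by rewrite -lecR rmorphD /= -!cmodE ler_normD. Qed.

Lemma cmodN z : cmod (- z) = cmod z.
Proof. by rewrite /cmod normrN. Qed.

Lemma cmodB z w : cmod (z - w) <= cmod z + cmod w.
Proof. by rewrite -(cmodN w) cmodD. Qed.

Lemma cmodC z w : cmod (z - w) = cmod (w - z).
Proof. by rewrite -cmodN opprB. Qed.

Lemma cmod0 : cmod 0 = 0.
Proof. by rewrite /cmod normr0. Qed.

Lemma cmod_eq0 z : (cmod z == 0) = (z == 0).
Proof. by rewrite -(inj_eq (@complexI R)) /= -cmodE normr_eq0. Qed.

Lemma cmod_gt0 z : (0 < cmod z) = (z != 0).
Proof. by rewrite lt_neqAle cmod_ge0 eq_sym cmod_eq0 andbT. Qed.

Lemma cmodV z : cmod z^-1 = (cmod z)^-1.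
Proof. by apply: complexI; rewrite fmorphV /= -!cmodE normfV. Qed.

Lemma cmodX z n : cmod (z ^+ n) = cmod z ^+ n.
Proof. by apply: complexI; rewrite rmorphXn /= -!cmodE normrX. Qed.

Lemma Re_le_cmod z : `|Re z| <= cmod z.
Proof. by rewrite -lecR -cmodE; exact: normc_ge_Re. Qed.

Lemma cmod_def z : cmod z = Num.sqrt (Re z ^+ 2 + Im z ^+ 2).
Proof. by case: z. Qed.

Lemma Im_le_cmod z : `|Im z| <= cmod z.
Proof. by rewrite cmod_def -sqrtr_sqr; apply: ler_wsqrtr; rewrite lerDr sqr_ge0.
  Qed.

Lemma cmod_le_ReIm z : cmod z <= `|Re z| + `|Im z|.
Proof.
rewrite cmod_def -[leRHS]ger0_norm ?addr_ge0 // -[leRHS]sqrtr_sqr.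
apply: ler_wsqrtr.
rewrite sqrrD !real_normK ?num_real //.
have : 0 <= `|Re z| * `|Im z| by rewrite mulr_ge0.
lra.
Qed.

Lemma gt0_complex (e : C) : 0 < e -> exists2 d : R, 0 < d & e = toC d.
Proof.
move=> e0; exists (Re e); last by rewrite RRe_real // gtr0_real.
by move: e0; rewrite ltcE => /andP[].
Qed.

Lemma continuous_cmod (f : C -> C) z : {for z, continuous f} ->
  forall e : R, 0 < e -> exists2 d : R, 0 < d &
    forall y, cmod (y - z) < d -> cmod (f y - f z) < e.
Proof.
move=> /cvgrPdist_lt fz e e0.
have [|d /= d0 hd] := (nbhs_ballP _ _).1 (fz (toC e) _); first by rewrite ltcR.
have [d' d'0 dE] := gt0_complex d0; exists d' => // y hy.
rewrite cmodC -cmod_lt; apply: hd; rewrite /ball /= dE cmod_lt cmodC //.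
Qed.

Lemma derivable_cmod (f : C -> C) z : derivable f z 1 ->
  forall e : R, 0 < e -> exists2 d : R, 0 < d & forall y, cmod (y - z) < d ->
    cmod (f y - f z - 'D_1 f z * (y - z)) <= e * cmod (y - z).
Proof.
move=> dfz e e0.
have /cvgrPdist_le/(_ (toC e)) : (fun h : C =>
  h^-1 *: ((f \o shift z) (h *: 1) - f z))
  @ 0^' --> 'D_1 f z by exact: dfz.
rewrite ltcR => /(_ e0) /(nbhs_ballP _ _).1[d /= d0 hd].
have [d' d'0 dE] := gt0_complex d0; exists d' => // y hy.
have [->|yz] := eqVneq y z.
  by rewrite !subrr mulr0 subr0 cmod0 mulr0.
have yz0 : y - z != 0 by rewrite subr_eq0.
have := hd (y - z); rewrite /ball /= sub0r normrN dE cmod_lt => /(_ hy yz0).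
rewrite /GRing.scale /= mulr1 subrK cmod_le => H.
rewrite (_ : _ - _ = - (y - z) * ('D_1 f z - (y - z)^-1 * (f y - f z))); last first.
  by field.
by rewrite cmodM cmodN mulrC ler_wpM2r // cmod_ge0.
Qed.

Lemma cmod_continuous (f : C -> C) z :
  (forall e : R, 0 < e -> exists2 d : R, 0 < d &
     forall y, cmod (y - z) < d -> cmod (f y - f z) < e) ->
  {for z, continuous f}.
Proof.
move=> hf; apply/(@cvgrPdist_lt _ _ _ (nbhs z) (nbhs_filter z)) =>
  e /gt0_complex[e' e'0 ->].
have [d d0 hd] := hf e' e'0; apply/nbhs_ballP; exists (toC d);
  first by rewrite /= ltcR.
move=> y; rewrite /ball /= cmod_lt => hy.
by rewrite cmod_lt cmodC hd // cmodC.
Qed.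

Lemma near_neq z b : z != b -> \forall y \near z, y != b.
Proof.
move=> zb; apply/nbhs_ballP; exists `|z - b|;
  first by rewrite /= normr_gt0 subr_eq0.
move=> y; rewrite /ball /= => h; apply: contraTneq h => ->.
by rewrite ltxx.
Qed.

End Modulus.
Global Opaque cmod.

(** * Logarithmic polar coordinates *)

Section Polar.
Variable R : realType.
Local Notation C := (Cx R).
Local Notation Re := complex.Re.
Local Notation Im := complex.Im.

Lemma is_derive_expansion (f : R -> R) (s l e : R) :
  is_derive s 1 f l -> 0 < e -> exists2 d : R, 0 < d & forall s' : R,
    `|s' - s| < d -> `|f s' - f s - l * (s' - s)| <= e * `|s' - s|.
Proof.
move=> [dfs fl] e0.
have /cvgrPdist_le/(_ e e0)/(nbhs_ballP _ _).1[d /= d0 hd] :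
  (fun h : R => h^-1 *: ((f \o shift s) (h *: 1) - f s)) @ 0^' --> 'D_1 f s
    by exact: dfs.
exists d => // y hy.
have [->|yz] := eqVneq y s; first by rewrite !subrr mulr0 subr0 normr0 mulr0.
have yz0 : y - s != 0 by rewrite subr_eq0.
have := hd (y - s); rewrite /ball /= sub0r normrN => /(_ hy yz0).
rewrite /GRing.scale /= mulr1 subrK fl => H.
rewrite (_ : _ - _ = - (y - s) * (l - (y - s)^-1 * (f y - f s))); last by field.
by rewrite normrM normrN mulrC ler_wpM2r.
Qed.

Lemma product_expansion (f g : R -> R) (s t f' g' e : R) :
  is_derive s 1 f f' -> is_derive t 1 g g' -> 0 < e ->
  exists2 d : R, 0 < d & forall s' t' : R, `|s' - s| < d -> `|t' - t| < d ->
    `|f s' * g t' - f s * g t - (f' * g t * (s' - s) + f s * g' * (t' - t))|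
      <= e * (`|s' - s| + `|t' - t|).
Proof.
move=> hf hg e0.
pose M := `|f s| + `|g t| + `|f'| + `|g'| + 1.
have [N1 N2 N3 N4] : [/\ 0 <= `|f s|, 0 <= `|g t|, 0 <= `|f'| & 0 <= `|g'|] by [].
have M1 : 1 <= M by rewrite /M; lra.
have M0 : 0 < M by lra.
have e1 : 0 < e / (4 * M) by rewrite divr_gt0 // mulr_gt0.
have [d1 d10 H1] := is_derive_expansion hf e1.
have [d2 d20 H2] := is_derive_expansion hg e1.
have [d3 d30 H3] := is_derive_expansion hg ltr01.
have e2 : 0 < e / (4 * M ^+ 2) by rewrite divr_gt0 // mulr_gt0 // exprn_gt0.
exists (Num.min (Num.min d1 d2) (Num.min d3 (Num.min 1 (e / (4 * M ^+ 2))))).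
  by rewrite !lt_min d10 d20 d30 e2 ltr01.
move=> s' t'; rewrite !lt_min => /andP[/andP[s1 _] /and3P[_ _ s2]].
case/and3P => /andP[_ t1] t2 /andP[t3 t4].
have {}H1 := H1 s' s1; have {}H2 := H2 t' t1; have {}H3 := H3 t' t2.
(* Error of f, product of the two increments, error of g; their shares of the bound are e / 2, e / 4
   and e / 4. *)
rewrite (_ : _ - _ = (f s' - f s - f' * (s' - s)) * g t' +
  f' * (s' - s) * (g t' - g t) + f s * (g t' - g t - g' * (t' - t))); last by ring.
have gt1 : `|g t' - g t| <= M * `|t' - t|.
  rewrite -(subrK (g' * (t' - t)) (_ - _)).
  apply: le_trans (ler_normD _ _) _; rewrite normrM.
  by rewrite (le_trans (lerD H3 (lexx _))) // -mulrDl ler_wpM2r // /M; lra.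
have gt2 : `|g t'| <= 2 * M.
  rewrite -(subrK (g t) (g t')); apply: le_trans (ler_normD _ _) _.
  apply: le_trans (lerD gt1 (lexx _)) _.
  have : M * `|t' - t| <= M * 1 by rewrite ler_wpM2l // ltW.
  rewrite /M; lra.
have T1 : `|(f s' - f s - f' * (s' - s)) * g t'| <= e / 2 * `|s' - s|.
  rewrite normrM; apply: le_trans (ler_pM _ _ H1 gt2) _ => //.
  by rewrite le_eqVlt; apply/orP; left; apply/eqP; field; lra.
have T2 : `|f' * (s' - s) * (g t' - g t)| <= e / 4 * `|t' - t|.
  rewrite !normrM.
  have : `|f'| * `|s' - s| * `|g t' - g t| <= M * (e / (4 * M ^+ 2)) * (M * `|t'
    - t|).
    apply: ler_pM; rewrite ?mulr_ge0 //.
    by apply: ler_pM => //; [rewrite /M; lra|exact: ltW].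
  by move=> /le_trans; apply; rewrite le_eqVlt; apply/orP; left; apply/eqP;
    field; lra.
have T3 : `|f s * (g t' - g t - g' * (t' - t))| <= e / 4 * `|t' - t|.
  rewrite normrM.
  have : `|f s| * `|g t' - g t - g' * (t' - t)| <= M * (e / (4 * M) * `|t' - t|).
    by apply: ler_pM => //; rewrite /M; lra.
  by move=> /le_trans; apply; rewrite le_eqVlt; apply/orP; left; apply/eqP;
    field; lra.
apply: le_trans (ler_normD _ _) _; apply: le_trans (lerD (ler_normD _ _) T3) _.
have : 0 <= e * `|s' - s| by rewrite mulr_ge0 // ltW.
have : 0 <= e * `|t' - t| by rewrite mulr_ge0 // ltW.
lra.
Qed.

(** This is a + exp (s + i t). Taking the logarithm of the radius as coordinate makes the map
    holomorphic in s + i t, and circles about [a] become vertical sides of rectangles. *)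
Definition polar (a : C) (s t : R) : C :=
  a + Complex (expR s * cos t) (expR s * sin t).

Lemma polar_expansion (a : C) (s t e : R) : 0 < e ->
  exists2 d : R, 0 < d & forall s' t' : R, `|s' - s| < d -> `|t' - t| < d ->
    cmod (polar a s' t' - polar a s t -
          (polar a s t - a) * Complex (s' - s) (t' - t))
      <= e * (`|s' - s| + `|t' - t|).
Proof.
move=> e0; have e2 : 0 < e / 2 by lra.
have [d1 d10 H1] := product_expansion (is_derive_expR s) (is_derive_cos t) e2.
have [d2 d20 H2] := product_expansion (is_derive_expR s) (is_derive_sin t) e2.
exists (Num.min d1 d2); first by rewrite lt_min d10.
move=> s' t'; rewrite !lt_min => /andP[s1 s2] /andP[t1 t2].
apply: le_trans (cmod_le_ReIm _) _.
have {}H1 := H1 s' t' s1 t1; have {}H2 := H2 s' t' s2 t2.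
rewrite /polar (_ : a + _ - (a + _) - _ = Complex
   (expR s' * cos t' - expR s * cos t -
     (expR s * cos t * (s' - s) + expR s * (- sin t) * (t' - t)))
   (expR s' * sin t' - expR s * sin t -
     (expR s * sin t * (s' - s) + expR s * cos t * (t' - t)))).
  by rewrite /=; lra.
case: a => a1 a2; simpc; congr Complex; ring.
Qed.

(** Chain rule with k = u'(z) (z - a). That the linear part is multiplication by one complex number
    is the Cauchy-Riemann equations, which will give the symmetric Jacobian required by
    [goursat]. *)
Lemma comp_polar_expansion (u : C -> C) (a : C) (s t : R) :
  derivable u (polar a s t) 1 -> exists k : C, forall e : R, 0 < e ->
  exists2 d : R, 0 < d & forall s' t' : R, `|s' - s| < d -> `|t' - t| < d ->
    cmod (u (polar a s' t') - u (polar a s t) - k * Complex (s' - s) (t' - t))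
      <= e * (`|s' - s| + `|t' - t|).
Proof.
move=> /derivable_cmod; set z := polar a s t; move: ('D_1 u z) => c hc.
exists (c * (z - a)) => e e0.
pose M := cmod (z - a) + 1; pose K := cmod c + 1.
have M0 : 0 < M by rewrite ltr_wpDl ?cmod_ge0.
have K0 : 0 < K by rewrite ltr_wpDl ?cmod_ge0.
have e1 : 0 < e / (2 * M) by rewrite divr_gt0 // mulr_gt0.
have [d1 d10 {}hc] := hc _ e1.
have e2 : 0 < Num.min 1 (e / (2 * K)) by rewrite lt_min ltr01 divr_gt0 // mulr_gt0.
have [d2 d20 hp] := polar_expansion a s t e2.
have d3 : 0 < d1 / (2 * M) by rewrite divr_gt0 // mulr_gt0.
exists (Num.min d2 (d1 / (2 * M))); first by rewrite lt_min d20.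
move=> s' t'; rewrite !lt_min => /andP[s1 s2] /andP[t1 t2].
have {}hp := hp s' t' s1 t1.
rewrite -/z in hp; set z' := polar a s' t' in hp *.
set w : C := Complex _ _ in hp *; set D := `|s' - s| + `|t' - t| in hp *.
have D0 : 0 <= D by rewrite addr_ge0.
have zz : cmod (z' - z) <= M * D.
  rewrite -(subrK ((z - a) * w) (z' - z)); apply: le_trans (cmodD _ _) _.
  rewrite cmodM /M [leRHS]mulrDl mul1r addrC; apply: lerD.
    by rewrite ler_wpM2l ?cmod_ge0 //; exact: cmod_le_ReIm.
  by apply: le_trans hp _; rewrite -[leRHS]mul1r ler_wpM2r // ge_min lexx.
have zd : cmod (z' - z) < d1.
  apply: le_lt_trans zz _; rewrite mulrC -ltr_pdivlMr //.
  have E : d1 / M = d1 / (2 * M) + d1 / (2 * M) by field; lra.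
  by rewrite E; apply: ltrD.
have {}hc := hc _ zd.
rewrite (_ : _ - _ = (u z' - u z - c * (z' - z)) + c * (z' - z - (z - a) * w));
  last by ring.
apply: le_trans (cmodD _ _) _; rewrite cmodM.
have T1 : e / (2 * M) * cmod (z' - z) <= e / 2 * D.
  have : e / (2 * M) * cmod (z' - z) <= e / (2 * M) * (M * D)
    by rewrite ler_wpM2l // ltW.
  by move=> /le_trans; apply; rewrite le_eqVlt; apply/orP; left; apply/eqP;
    field; lra.
have T2 : cmod c * cmod (z' - z - (z - a) * w) <= e / 2 * D.
  have : cmod c * cmod (z' - z - (z - a) * w) <= K * (e / (2 * K) * D).
    apply: ler_pM; rewrite ?cmod_ge0 //; first by rewrite /K; lra.
    by apply: le_trans hp _; rewrite ler_wpM2r // ge_min lexx orbT.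
  by move=> /le_trans; apply; rewrite le_eqVlt; apply/orP; left; apply/eqP;
    field; lra.
by have := le_trans hc T1; lra.
Qed.

End Polar.

(** * Mean values over circles *)

Section MeanValue.
Variable R : realType.
Local Notation C := (Cx R).
Local Notation Re := complex.Re.
Local Notation Im := complex.Im.

Lemma primitive_exists (g : R -> R) (L : R) : continuous g ->
  exists G : R -> R, forall x, L < x -> is_derive x 1 G (g x).
Proof.
move=> gc; exists (fun x => \int[@lebesgue_measure R]_(t in `[L, x]) g t) => x Lx.
have int : (@lebesgue_measure R).-integrable `[L, x + 1] (EFin \o g).
  apply: continuous_compact_integrable; first exact: segment_compact.
  exact: continuous_subspaceT.
have [|d <-] := @continuous_FTC1_closed R g L x (x + 1) _ int Lx (gc x).
  by rewrite ltrDl.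
by rewrite derive1E; split.
Qed.

(** The primitive is a function of [g] alone, so equal integrands have equal primitives; this is
    what closes up the circle at angle 2 pi. The default value is not reached for continuous [g]. *)
Definition prim (L : R) (g : R -> R) : R -> R :=
  match pselect (exists G : R -> R, forall x, L < x -> is_derive x 1 G (g x)) with
  | left h => projT1 (cid h) | right _ => cst 0 end.

Lemma primP (L : R) (g : R -> R) (x : R) : continuous g -> L < x ->
  is_derive x 1 (prim L g) (g x).
Proof.
move=> gc Lx; rewrite /prim; case: pselect => [h|[]].
  by case: cid => G /=; apply.
exact: primitive_exists.
Qed.

(* T will hold the log radii of the circles that meet the exceptional set. *)
Lemma piecewise_constant (m : R -> R) (T : seq R) :
  (forall s e : R, 0 < e -> exists2 d : R, 0 < d & forall s' : R,
     `|s' - s| < d -> `|m s' - m s| <= e) ->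
  (forall s1 s2 : R, s1 <= s2 -> (forall s, s1 <= s <= s2 -> s \notin T) ->
     m s1 = m s2) ->
  forall s1 s2, s1 <= s2 -> m s1 = m s2.
Proof.
move=> mc; elim: T => [|c T IH] mT; first by move=> s1 s2 /mT; apply.
apply: IH => s1 s2 s12 sT.
have [c_in|c_out] := boolP (s1 <= c <= s2); last first.
  apply: mT => // s hs; rewrite in_cons negb_or sT // andbT.
  by apply: contraNneq c_out => <-.
have lim s0 : s1 <= s0 <= s2 -> (forall s,
  s0 <= s < c \/ c < s <= s0 -> m s = m s0) ->
    m s0 = m c.
  move=> hs0 hm; apply/eqP; rewrite eq_sym -subr_eq0 -normr_le0.
  apply/ler_addgt0Pr => e e0; rewrite add0r.
  have [d d0 hd] := mc c e e0.
  have [E|cs] := eqVneq c s0; first by rewrite E subrr normr0 ltW.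
  have /orP[lt_sc|gt_sc] : (s0 < c) || (c < s0) by rewrite -neq_lt eq_sym.
    (* A point within [d] of [c] but strictly before [c] and not before [s0], where m still has the
       value m s0. *)
    rewrite -(hm (Num.max s0 (c - d / 2))); last first.
      by left; rewrite le_max lexx gt_max lt_sc /=; lra.
    rewrite distrC; apply: hd; rewrite distrC ger0_norm ?subr_ge0 ?ge_max.
      by rewrite ltrBlDl -ltrBlDr lt_max; apply/orP; right; lra.
    by rewrite ltW //=; lra.
  rewrite -(hm (Num.min s0 (c + d / 2))); last first.
    by right; rewrite ge_min lexx lt_min gt_sc /=; lra.
  rewrite distrC; apply: hd; rewrite ger0_norm ?subr_ge0 ?le_min.
    by rewrite ltrBlDl gt_min; apply/orP; right; lra.
  by rewrite ltW //=; lra.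
rewrite (lim s1) ?lexx ?s12 //; last first.
  move=> s [/andP[h1 h2]|/andP[h1 h2]]; last by case/andP: c_in; lra.
  rewrite (mT s1 s) // => s' /andP[h3 h4]; rewrite in_cons negb_or.
  by rewrite lt_eqF ?(le_lt_trans h4) //= sT // h3; case/andP: c_in; lra.
rewrite (lim s2) ?lexx ?s12 // => s [/andP[h1 h2]|/andP[h1 h2]].
  by case/andP: c_in; lra.
rewrite (mT s s2) // => s' /andP[h3 h4]; rewrite in_cons negb_or.
by rewrite gt_eqF ?(lt_le_trans h1) //= sT // h4; case/andP: c_in; lra.
Qed.


Lemma polar_continuous (a : C) (s t e : R) : 0 < e ->
  exists2 d : R, 0 < d & forall s' t' : R, `|s' - s| < d -> `|t' - t| < d ->
    cmod (polar a s' t' - polar a s t) < e.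
Proof.
move=> e0; have [d d0 hd] := polar_expansion a s t (@ltr01 R).
set z := polar a s t in hd *; pose M := cmod (z - a) + 1.
have M0 : 0 < M by rewrite ltr_wpDl ?cmod_ge0.
exists (Num.min d (e / (2 * M))); first by rewrite lt_min d0 divr_gt0 // mulr_gt0.
move=> s' t'; rewrite !lt_min => /andP[s1 s2] /andP[t1 t2].
have {}hd := hd s' t' s1 t1.
rewrite -(subrK ((z - a) * Complex (s' - s) (t' - t)) (_ - z)).
apply: le_lt_trans (cmodD _ _) _; rewrite cmodM.
have h : cmod (z - a) * cmod (Complex (s' - s) (t' - t)) <=
    cmod (z - a) * (`|s' - s| + `|t' - t|).
  by apply: ler_wpM2l; [exact: cmod_ge0|exact: cmod_le_ReIm].
apply: le_lt_trans (lerD hd h) _; rewrite -mulrDl addrC -/M.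
rewrite mulrC -ltr_pdivlMr // (_ : e / M = e / (2 * M) + e / (2 * M));
  first exact: ltrD.
by field; lra.
Qed.

Lemma comp_polar_continuous (u : C -> C) (a : C) (s t e : R) : continuous u ->
  0 < e ->
  exists2 d : R, 0 < d & forall s' t' : R, `|s' - s| < d -> `|t' - t| < d ->
    cmod (u (polar a s' t') - u (polar a s t)) < e.
Proof.
move=> uc e0; have [d d0 hd] := continuous_cmod (uc (polar a s t)) e0.
have [d' d'0 hd'] := polar_continuous a s t d0.
by exists d' => // s' t' s1 t1; apply: hd; apply: hd'.
Qed.

Lemma continuous_eps (g : R -> R) :
  (forall s e : R, 0 < e -> exists2 d : R, 0 < d & forall s',
    `|s' - s| < d -> `|g s' - g s| < e) ->
  continuous g.
Proof.
move=> hg s; apply/cvgrPdist_lt => e e0; have [d d0 hd] := hg s e e0.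
apply/nbhs_ballP; exists d => // s' hs; rewrite distrC; apply: hd.
by rewrite distrC.
Qed.

Section CircleMean.
Variables (u : C -> C) (a : C).
Hypothesis uc : continuous u.

(** P ds + Q dt is the real part of u(z) dz / (i (z - a)); on a circle about [a] only the term Re u
    dt survives. *)
Let Q (s t : R) : R := Re (u (polar a s t)).
Let P (s t : R) : R := Im (u (polar a s t)).

Let Qc s : continuous (Q s).
Proof.
apply: continuous_eps => t e e0.
have [d d0 hd] := comp_polar_continuous a s t uc e0; exists d => // t' ht.
apply: le_lt_trans (hd s t' _ ht); last by rewrite subrr normr0.
by apply: le_trans (Re_le_cmod _); rewrite raddfB.
Qed.

Let Pc t : continuous (P^~ t).
Proof.
apply: continuous_eps => s e e0.
have [d d0 hd] := comp_polar_continuous a s t uc e0; exists d => // s' hs.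
apply: le_lt_trans (hd s' t hs _); last by rewrite subrr normr0.
by apply: le_trans (Im_le_cmod _); rewrite raddfB.
Qed.

(** The primitive is based at -1, to the left of 0, so that it is differentiable on the whole closed
    interval [0, 2 pi]. *)
Definition circle_integral (s : R) : R :=
  prim (- 1) (Q s) (2 * pi) - prim (- 1) (Q s) 0.

Let pi2 : 0 <= 2 * pi :> R.
Proof. by rewrite mulr_ge0 // pi_ge0. Qed.

Lemma circle_integral_approx (s c e : R) :
  (forall t, 0 <= t <= 2 * pi -> `|Q s t - c| <= e) ->
  `|circle_integral s - c * (2 * pi)| <= e * (2 * pi).
Proof.
rewrite -{1}[2 * pi]add0r => h.
have H1 t : 0 <= t <= 0 + 2 * pi -> is_derive t 1 (prim (- 1) (Q s)) (Q s t).
  by move=> /andP[t0 _]; apply: primP => //; apply: lt_le_trans t0; rewrite ltrN10.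
have H2 t : 0 <= t <= 0 + 2 * pi -> is_derive t 1 (c *: id) ((cst c : R -> R) t).
  by move=> _; apply: is_derive_eq (is_deriveZ c (is_derive_id t 1)) _;
    rewrite /GRing.scale /= mulr1.
have := primitive_approx pi2 H1 H2 h.
by rewrite add0r /circle_integral /= !fctE /GRing.scale /= mulr0 subr0.
Qed.

Lemma circle_integral_close (s s0 e : R) :
  (forall t, 0 <= t <= 2 * pi -> `|Q s t - Q s0 t| <= e) ->
  `|circle_integral s - circle_integral s0| <= e * (2 * pi).
Proof.
move=> h.
have := @primitive_approx R (prim (- 1) (Q s)) (prim (-1) (Q s0)) (Q s) (Q s0) 0
  (2 * pi) e pi2.
by rewrite add0r; apply => // t /andP[t0 _]; apply: primP => //;
  apply: lt_le_trans t0; rewrite ltrN10.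
Qed.

Lemma circle_integral_continuous (s0 e : R) : 0 < e ->
  exists2 d : R, 0 < d & forall s, `|s - s0| < d ->
    `|circle_integral s - circle_integral s0| <= e.
Proof.
move=> e0; have pi0 : 0 < 2 * pi :> R by rewrite mulr_gt0 // pi_gt0.
have e1 : 0 < e / (2 * pi) by rewrite divr_gt0.
set e' := e / (2 * pi) in e1.
suff [d d0 hd] : exists2 d : R, 0 < d & forall s, `|s - s0| < d ->
    forall t, 0 <= t <= 0 + 2 * pi -> `|Q s t - Q s0 t| <= e'.
  exists d => // s /hd h; rewrite -[e](divfK (lt0r_neq0 pi0)).
  by apply: circle_integral_close => t ht; apply: h; rewrite add0r.
(* Uniformity in t over the compact interval [0, 2 pi], by bisection of a rectangle of width 0. *)
have := @rectangle_bisection R (fun _ b _ h => exists2 d : R, 0 < d &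
  forall s, `|s - s0| < d -> forall t, b <= t <= b + h -> `|Q s t - Q s0 t| <= e')
  0 0 0 (2 * pi).
apply=> //.
- move=> a' b w h /= [d1 d10 h1] _ [d2 d20 h2] _.
  exists (Num.min d1 d2); first by rewrite lt_min d10.
  move=> s; rewrite lt_min => /andP[s1 s2] t /andP[t1 t2].
  have [tb|tb] := leP t (b + h / 2); first by apply: h1 => //; rewrite t1.
  by apply: h2 => //; rewrite (ltW tb) -addrA -splitr.
- move=> x y _ _; have e2 : 0 < e' / 2 by lra.
  have [d d0 hd] := comp_polar_continuous a s0 y uc e2.
  exists d => // a' b n _ hy _ hn; exists d => // s hs t ht.
  have ty : `|t - y| < d by rewrite ltr_norml; lra.
  have H1 := le_lt_trans (Re_le_cmod _) (hd s t hs ty).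
  have H2 : `|Re (u (polar a s0 t) - u (polar a s0 y))| < e' / 2.
    by apply: le_lt_trans (Re_le_cmod _) (hd s0 t _ ty); rewrite subrr normr0.
  move: H1 H2; rewrite !raddfB /= -/(Q s t) -/(Q s0 t) -/(Q s0 y) !ltr_norml
    ler_norml.
  lra.
Qed.

(** Goursat on [s1, s2] x [0, 2 pi]: the two circles are the vertical sides, and the horizontal
    sides cancel because [polar] is periodic in t. *)
Lemma circle_integral_const (s1 s2 : R) : s1 <= s2 ->
  (forall s t, s1 <= s <= s2 -> derivable u (polar a s t) 1) ->
  circle_integral s1 = circle_integral s2.
Proof.
move=> s12 hd.
have s12' : s1 + (s2 - s1) = s2 by rewrite addrC subrK.
have := @goursat R P Q (fun s t => prim (s1 - 1) (P^~ t) s) (fun s =>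
  prim (- 1) (Q s))
  s1 0 (s2 - s1) (2 * pi).
rewrite /boundary_sum s12' add0r subr_ge0 => H.
suff : prim (s1 - 1) (P^~ (2 * pi)) = prim (s1 - 1) (P^~ 0).
  rewrite /circle_integral => E; move: H; rewrite E subrr add0r => H.
  apply/eqP; rewrite eq_sym -subr_eq0; apply/eqP; apply: H => //.
  - move=> s t /andP[h1 h2] _; apply: (@primP (s1 - 1) (P^~ t)) => //; lra.
  - by move=> s t _ /andP[t0 _]; apply: primP => //; apply: lt_le_trans t0;
    rewrite ltrN10.
  move=> s t hs0 _; have [k hk] := comp_polar_expansion (hd s t hs0).
  exists (Im k), (Re k), (- Im k) => e e0; have [d d0 {}hk] := hk e e0.
  exists d => // s' t' hs ht; have {}hk := hk s' t' hs ht.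
  split; apply: le_trans hk.
    apply: le_trans (Im_le_cmod _); rewrite !raddfB /= -/(P _ _) -/(P _ _).
    by rewrite le_eqVlt; apply/orP; left; apply/eqP; congr `|_|;
      case: (k) => k1 k2 /=; ring.
  apply: le_trans (Re_le_cmod _); rewrite !raddfB /= -/(Q _ _) -/(Q _ _).
  by rewrite le_eqVlt; apply/orP; left; apply/eqP; congr `|_|;
    case: (k) => k1 k2 /=; ring.
congr prim; apply/funext => s; rewrite /P /polar.
by rewrite mulr_natl cos2pi sin2pi cos0 sin0.
Qed.

End CircleMean.
End MeanValue.

(** * Liouville theorem *)

Section Liouville.
Variable R : realType.
Local Notation C := (Cx R).
Local Notation Re := complex.Re.
Local Notation Im := complex.Im.

Lemma cmod_polar (a : C) (s t : R) : cmod (polar a s t - a) = expR s.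
Proof.
rewrite /polar addrC addKr cmod_def /= !exprMn -mulrDr cos2Dsin2 mulr1.
by rewrite sqrtr_sqr ger0_norm // expR_ge0.
Qed.

(** The integral of Re u over circles about [a] does not depend on the radius, continuity bridging
    the circles that meet [S]. Small circles give 2 pi Re (u a), large ones give 0 by decay. *)
Lemma decay_Re_eq0 (u : C -> C) (S : seq C) (A T : R) : continuous u ->
  (forall z, z \notin S -> derivable u z 1) ->
  (forall z, T <= cmod z -> cmod (u z) * cmod z <= A) ->
  forall a, Re (u a) = 0.
Proof.
move=> uc ud uA a; pose m := circle_integral u a.
have pi0 : 0 < 2 * pi :> R by rewrite mulr_gt0 // pi_gt0.
have mconst s1 s2 : m s1 = m s2.
  wlog s12 : s1 s2 / s1 <= s2 => [H|].
    by have [/H//|/ltW/H->] := leP s1 s2.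
  move: s1 s2 s12; apply: (@piecewise_constant _ m [seq ln (cmod (b - a)) | b <-
    S]).
    by move=> s e; exact: circle_integral_continuous.
  move=> s1 s2 s12 hs; apply: circle_integral_const => // s t /hs sS.
  apply: ud; apply: contra sS => pS; apply/mapP; exists (polar a s t) => //.
  by rewrite cmod_polar expRK.
apply/eqP; rewrite -normr_le0; apply/ler_addgt0Pr => e e0; rewrite add0r.
have e2 : 0 < e / 2 by lra.
have [d d0 hd] := continuous_cmod (uc a) e2.
have E1 : `|m (ln (d / 2)) - Re (u a) * (2 * pi)| <= e / 2 * (2 * pi).
  apply: circle_integral_approx => // t _.
  rewrite -raddfB; apply: le_trans (Re_le_cmod _) (ltW (hd _ _)).
  by rewrite cmod_polar lnK ?posrE; lra.
(* On the circle of radius r about [a] one has |z| >= r - |a|, which exceeds both T and |A| / (e /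
   2); the decay hypothesis then gives |u z| <= e / 2. *)
pose r := 1 + cmod a + `|T| + `|A| / (e / 2).
have a0 := cmod_ge0 a; have T0 := normr_ge0 T.
have A0 : 0 <= `|A| / (e / 2) by rewrite divr_ge0 // ltW.
have r0 : 0 < r by rewrite /r; lra.
have E2 : `|m (ln r) - 0 * (2 * pi)| <= e / 2 * (2 * pi).
  apply: circle_integral_approx => // t _; rewrite subr0.
  apply: le_trans (Re_le_cmod _) _; set z := polar _ _ _.
  have zr : r <= cmod z + cmod a.
    apply: le_trans (cmodB _ _); rewrite cmod_polar lnK //.
  have zT : T <= cmod z by have := ler_norm T; rewrite /r in zr; lra.
  have z0 : 0 < cmod z by rewrite /r in zr; lra.
  rewrite -(ler_pM2r z0); apply: le_trans (uA z zT) _.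
  apply: le_trans (ler_norm A) _.
  rewrite -ler_pdivrMl // mulrC; rewrite /r in zr; lra.
rewrite (mconst _ (ln r)) in E1; rewrite mul0r subr0 in E2.
have : `|Re (u a) * (2 * pi)| <= e * (2 * pi).
  move: E1 E2; rewrite !ler_norml; lra.
by rewrite normrM (gtr0_norm pi0) ler_pM2r.
Qed.

Lemma decay_eq0 (u : C -> C) (S : seq C) (A T : R) : continuous u ->
  (forall z, z \notin S -> derivable u z 1) ->
  (forall z, T <= cmod z -> cmod (u z) * cmod z <= A) ->
  forall a, u a = 0.
Proof.
move=> uc ud uA a; apply/eqP; rewrite eq_complex (decay_Re_eq0 uc ud uA) eqxx /=.
have [i iE iIm] : exists2 i : C, cmod i = 1 & forall z : C, Im z = - Re (z * i).
  exists (Complex 0 1 : C); first by rewrite cmod_def /= expr0n expr1n add0r sqrtr1.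
  by case=> x y; rewrite /= mulr0 mulr1 sub0r opprK.
rewrite iIm.
pose v (z : C) : C := u z * i.
have vE : v = i *: u by apply/funext => z; rewrite /v mulrC.
have vc : continuous v.
  by move=> z; rewrite vE; apply: continuousZl_tmp; exact: uc.
have vd z : z \notin S -> derivable v z 1.
  by rewrite vE => zS; apply: derivableZ; exact: ud.
have vA z : T <= cmod z -> cmod (v z) * cmod z <= A.
  by move=> zT; rewrite /v cmodM iE mulr1; exact: uA.
by rewrite -/(v a) (decay_Re_eq0 vc vd vA) oppr0.
Qed.

Definition slope (g : C -> C) (b z : C) : C :=
  if z == b then 'D_1 g b else (z - b)^-1 * (g z - g b).

Lemma slopeE (g : C -> C) (b z : C) : g z = g b + (z - b) * slope g b z.
Proof.
rewrite /slope; have [->|zb] := eqVneq z b; first by rewrite subrr mul0r addr0.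
by rewrite mulrA divff ?subr_eq0 // mul1r addrC subrK.
Qed.

Lemma slope_derivable (g : C -> C) (b z : C) : z != b -> derivable g z 1 ->
  derivable (slope g b) z 1.
Proof.
move=> zb dg.
have d1 : derivable (fun y : C => (y - b)^-1) z 1.
  apply: (@derivableV _ _ (id - cst b)); first by rewrite !fctE subr_eq0.
  by apply: derivableB; [exact: derivable_id|exact: derivable_cst].
have d2 : derivable (g - cst (g b)) z 1 := derivableB dg (derivable_cst _ _ _).
have := derivableM d1 d2; apply: near_eq_derivable.
apply: filterS (near_neq zb) => y yb; rewrite /slope (negbTE yb).
by rewrite !fctE.
Qed.

Lemma slope_continuous (g : C -> C) (b : C) : continuous g -> derivable g b 1 ->
  continuous (slope g b).
Proof.
move=> gc gd z; have [->|zb] := eqVneq z b.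
  apply: cmod_continuous => e e0; have e2 : 0 < e / 2 by lra.
  have [d d0 hd] := derivable_cmod gd e2; exists d => // y /hd {}hd.
  have [->|yb] := eqVneq y b; first by rewrite subrr cmod0.
  have yb0 : 0 < cmod (y - b) by rewrite cmod_gt0 subr_eq0.
  rewrite {2}/slope eqxx -(ltr_pM2r yb0) -cmodM.
  apply: le_lt_trans (_ : e / 2 * cmod (y - b) < _); last by rewrite ltr_pM2r //;
    lra.
  rewrite (_ : _ * _ = g y - g b - 'D_1 g b * (y - b)) //.
  by have := slopeE g b y; move: (slope g b y) ('D_1 g b) => k k' ->; ring.
have c1 : {for z, continuous (fun y : C => (y - b)^-1)}.
  apply: (@continuousV _ _ (id - cst b)); first by rewrite !fctE subr_eq0.
  by apply: continuousB; [exact: cvg_id|exact: cst_continuous].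
have c2 : {for z, continuous (g - cst (g b))}.
  by apply: continuousB; [exact: gc|exact: cst_continuous].
have E : {near z, (fun y : C => (y - b)^-1 * (g y - g b)) =1 slope g b}.
  by apply: filterS (near_neq zb) => y yb; rewrite /slope (negbTE yb).
apply: cvg_trans (near_eq_cvg E) _.
by rewrite /slope (negbTE zb); exact: continuousM c1 c2.
Qed.

(* Newton interpolation: passing from g to its slope at b lowers the growth by one
   and adds b to the exceptional set S, where only continuity is known. *)
Lemma growth_poly (D : nat) (g : C -> C) (S : seq C) (A T : R) : continuous g ->
  (forall z, z \notin S -> derivable g z 1) ->
  (forall z, T <= cmod z -> cmod (g z) * cmod z <= A * cmod z ^+ D) ->
  exists2 p : {poly C}, (size p <= D)%N & forall z, g z = p.[z].
Proof.
elim: D g S A T => [|D IH] g S A T gc gd gA.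
  (* For D = 0 the growth hypothesis is decay like 1 / |z|. *)
  exists 0 => [|z]; first by rewrite size_poly0.
  by rewrite horner0; apply: (@decay_eq0 _ _ A T gc gd) => y yT; have := gA y yT;
    rewrite expr0 mulr1.
(* The modulus of b exceeds that of every point of S, so g is differentiable at b and its slope
   there is continuous. *)
pose b : C := (\sum_(z <- S) (cmod z) + 1)%:C%C.
have bS : b \notin S.
  apply/negP => bS; have : cmod b <= \sum_(z <- S) cmod z.
    by rewrite (big_rem b) //= lerDl sumr_ge0 // => i _; exact: cmod_ge0.
  have s0 : 0 <= \sum_(z <- S) cmod z by rewrite sumr_ge0 // => i _;
    exact: cmod_ge0.
  rewrite {1}cmod_def /= expr0n addr0 sqrtr_sqr ger0_norm; lra.
(* Beyond 2 |b| + 1 one has |z| <= 2 |z - b|, whence the factor 2, and |z| >= 1, so that the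
   constant g b is absorbed by |z|^D. *)
have [||z zT|p sp hp] := IH (slope g b) (b :: S) (2 * (A + cmod (g b))) (Num.max
  T (2 * cmod b + 1)).
- by apply: slope_continuous => //; exact: gd.
- by move=> z; rewrite in_cons negb_or => /andP[zb /gd]; exact: slope_derivable.
- move: zT; rewrite ge_max => /andP[zT zb].
  have b0 := cmod_ge0 b.
  have z0 : 0 < cmod z by lra.
  have zb2 : cmod z <= 2 * cmod (z - b).
    have := cmodD (z - b) b; rewrite subrK; lra.
  have z1 : 1 <= cmod z ^+ D by rewrite exprn_ege1 //; lra.
  have := gA z zT.
  have gs : cmod (slope g b z) * cmod (z - b) <= cmod (g z) + cmod (g b).
    rewrite -cmodM mulrC (_ : _ * _ = g z - g b) ?cmodB //.
    by have := slopeE g b z; move: (slope g b z) => k ->; ring.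
  rewrite exprS mulrCA mulrC ler_pM2l // => {}gA.
  have h1 : cmod (slope g b z) * cmod z <= 2 * (cmod (slope g b z) * cmod (z - b)).
    rewrite mulrCA; apply: ler_wpM2l => //; exact: cmod_ge0.
  have h2 : cmod (g b) <= cmod (g b) * cmod z ^+ D.
    by rewrite ler_peMr // cmod_ge0.
  lra.
exists ((g b)%:P + ('X - b%:P) * p).
  apply: leq_trans (size_polyD _ _) _; rewrite geq_max; apply/andP; split.
    by apply: leq_trans (size_polyC_leq1 _) _.
  by apply: leq_trans (size_polyMleq _ _) _; rewrite size_XsubC.
by move=> z; rewrite !hornerE -hp -slopeE.
Qed.

End Liouville.

(** * Homogeneous functions and forms *)

Section Forms.
Variables (K : numFieldType) (N : nat).
Implicit Types (p q : mpoly N K) (v : 'I_N -> K).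

Lemma poly_ext (p q : {poly K}) : (forall t, p.[t] = q.[t]) -> p = q.
Proof.
move=> h; apply/eqP; rewrite -subr_eq0; apply/eqP.
apply: (@roots_geq_poly_eq0 _ _ [seq i%:R | i <- iota 0 (size (p - q))]).
- by apply/allP => _ /mapP[i _ ->]; rewrite /root !hornerE h subrr.
- by rewrite map_inj_uniq ?iota_uniq // => i j /eqP; rewrite eqr_nat => /eqP.
- by rewrite size_map size_iota.
Qed.

(** The nodes are 0, ..., D - 1. The basis does not depend on [q], so the formula still applies when
    q varies with parameters. *)
Lemma lagrange_interpolation D : exists L : 'I_D -> {poly K},
  forall q : {poly K}, (size q <= D)%N -> q = \sum_(k < D) q.[k%:R] *: L k.
Proof.
pose L (k : 'I_D) := \prod_(l < D | l != k) ((k%:R - l%:R)^-1 *: ('X - (l%:R :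
  K)%:P)).
exists L => q sq.
have Lkk k : (L k).[k%:R] = 1.
  rewrite horner_prod big1 // => l lk; rewrite hornerZ hornerXsubC mulVf //.
  by rewrite subr_eq0 eqr_nat eq_sym.
have Lkl k l : l != k -> (L k).[l%:R] = 0.
  by move=> lk; rewrite horner_prod (bigD1 l) //= hornerZ hornerXsubC subrr mulr0
    mul0r.
have sL k : (size (L k) <= D)%N.
  apply: leq_trans (size_poly_prod_leq _ _) _.
  have : (\sum_(i < D | i != k) size ((k%:R - i%:R)^-1 *: ('X - (i%:R : K)%:P)) <=
    \sum_(i < D | i != k) 2)%N.
    by apply: leq_sum => i _; apply: leq_trans (size_scale_leq _ _) _;
      rewrite size_XsubC.
  have cE : #|(fun i : 'I_D => i != k)| = D.-1 by rewrite cardC1 card_ord.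
  rewrite sum_nat_const cE.
  have : (0 < D)%N by apply: leq_ltn_trans (ltn_ord k).
  by move: (\sum_(i < D | _) _)%N => s; lia.
apply/eqP; rewrite -subr_eq0; apply/eqP.
apply: (@roots_geq_poly_eq0 _ _ [seq (i : 'I_D)%:R | i <- enum 'I_D]).
- apply/allP => _ /mapP[i _ ->]; rewrite /root hornerD hornerN horner_sum.
  rewrite (bigD1 i) //= big1 ?addr0 => [|l li];
    rewrite hornerZ ?Lkk ?mulr1 ?subrr //.
  by rewrite Lkl 1?eq_sym // mulr0.
- by rewrite map_inj_uniq ?enum_uniq // => i j /eqP;
  rewrite eqr_nat => /eqP/ord_inj.
- rewrite size_map size_enum_ord; apply: leq_trans (size_polyD _ _) _.
  rewrite geq_max sq size_polyN; apply: leq_trans (size_sum _ _ _) _.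
  by apply/bigmax_leqP => i _; apply: leq_trans (size_scale_leq _ _) _.
Qed.

Lemma meval_homog d p v c : p \is ishomog1 d mdeg ->
  meval (fun i => c * v i) p = c ^+ d * meval v p.
Proof.
move=> /dhomogP hp; rewrite !mevalE mulr_sumr big_seq [RHS]big_seq.
apply: eq_bigr => m /hp <-; rewrite mulrCA; congr (_ * _).
rewrite (eq_bigr (fun i => c ^+ m i * v i ^+ m i)); last by move=> i _;
  rewrite exprMn.
by rewrite big_split /= prodrXr mdegE.
Qed.

(** Evaluated at c v, p is a polynomial in c whose coefficient of degree i is the value at v of the
    component of degree i; compare coefficients of degree D. *)
Lemma meval_homog_component D p : 
  (forall v c, meval (fun i => c * v i) p = c ^+ D * meval v p) ->
  forall v, meval v p = meval v (pihomog mdeg D p).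
Proof.
move=> hp v; pose k := maxn D.+1 (msize p).
have E := @pihomog_partitionE _ _ mdeg k p (leq_maxr _ _).
pose q := \poly_(i < k) meval v (pihomog mdeg i p).
have : q = meval v p *: 'X^D.
  apply: poly_ext => t; rewrite horner_poly !hornerE mulrC -hp {2}E raddf_sum /=.
  by apply: eq_bigr => i _; rewrite (meval_homog _ _ (pihomogP _ _ _)) mulrC.
move=> /(congr1 (fun q : {poly K} => q`_D)); rewrite coefZ coefXn eqxx mulr1 => <-.
by rewrite coef_poly leq_max ltnS leqnn.
Qed.

Lemma meval_horner v (i : 'I_N) (q : {poly K}) :
  meval v ((map_poly (@mpolyC N K) q).[mpolyX K (mnm1 i)]) = q.[v i].
Proof.
have := horner_map (meval v) (map_poly (@mpolyC N K) q) (mpolyX K (mnm1 i)).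
rewrite /= mevalXU => <-; rewrite -map_poly_comp /= map_poly_id // => c _.
exact: mevalC.
Qed.

(** The variables are freed one at a time, the others being frozen at [c]. By the uniform degree
    bound, the dependence on the new variable is interpolated from D fixed values, at which the
    induction hypothesis applies. *)
Lemma separately_poly D (g : 'rV[K]_N -> K) :
  (forall (x : 'rV[K]_N) i, exists2 p : {poly K}, (size p <= D)%N &
     forall t, g (\row_j (if j == i then t else x 0 j)) = p.[t]) ->
  exists P : mpoly N K, forall x : 'rV[K]_N, g x = meval (fun i => x 0 i) P.
Proof.
move=> hg.
suff H m : (m <= N)%N -> forall c : 'rV[K]_N, exists P : mpoly N K,
  forall x : 'rV[K]_N,
    g (\row_j (if (j < m)%N then x 0 j else c 0 j)) = meval (fun i => x 0 i) P.
  have [P hP] := H N (leqnn _) 0; exists P => x; rewrite -hP; congr g.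
  by apply/rowP => j; rewrite !mxE ltn_ord.
have [L hL] := lagrange_interpolation D.
elim: m => [_ c|m IH mN c].
  by exists (mpolyC N (g c)) => x; rewrite mevalC; congr g; apply/rowP => j;
    rewrite !mxE.
pose i := Ordinal mN.
pose c' (k : 'I_D) : 'rV[K]_N := \row_j (if j == i then k%:R else c 0 j).
have /choice[P hP] k := IH (ltnW mN) (c' k).
exists (\sum_(k < D) P k * (map_poly (@mpolyC N K) (L k)).[mpolyX K (mnm1 i)]) => x.
pose y : 'rV[K]_N := \row_j (if (j < m.+1)%N then x 0 j else c 0 j).
have [p sp hp] := hg y i; rewrite -/y.
have yE t : \row_j (if j == i then t else y 0 j) = \row_j (if (j < m)%N then x 0
  j else
   if j == i then t else c 0 j).
  apply/rowP => j; rewrite !mxE ltnS leq_eqVlt -val_eqE /=.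
  by have [->|_] := eqVneq (j : nat) m; rewrite ?ltnn.
have -> : g y = p.[x 0 i].
  by rewrite -hp; congr g; apply/rowP => j; rewrite !mxE; case: eqP => // ->;
    rewrite ltnSn.
rewrite {1}(hL p sp) horner_sum raddf_sum /=; apply: eq_bigr => k _.
rewrite hornerZ mevalM meval_horner -hP -hp yE; congr (g _ * _).
by apply/rowP => j; rewrite !mxE.
Qed.

End Forms.

Section HomogeneousFunctions.
Variables (R : realType) (N D : nat).
Local Notation C := (Cx R).
Variable L : 'rV[C]_N -> C.
Hypothesis Lhom : forall (c : C) x, L (c *: x) = c ^+ D * L x.
Hypothesis Ldiff : forall x, x != 0 -> differentiable L x.

Let line (x u : 'rV[C]_N) (t : C) := L (x + t *: u).

Let line_diff x u t : x + t *: u != 0 -> differentiable (line x u) t.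
Proof.
move=> xt0.
have d1 : differentiable (cst x + (fun t : C => t *: u)) t.
  apply: differentiableD; first exact: differentiable_cst.
  by have [] := is_diff_scalel t u.
exact: (@differentiable_comp _ _ _ _ (cst x + (fun t : C =>
  t *: u)) L t d1 (Ldiff xt0)).
Qed.

(** On a line through the origin, homogeneity gives a multiple of (t - t0)^D. On any other line L is
    differentiable, and L (x + t u) = t^D L (u + t^-1 x) together with continuity at u bounds the
    growth by |t|^D. *)
Lemma line_poly x u : exists2 p : {poly C}, (size p <= D.+1)%N &
  forall t, L (x + t *: u) = p.[t].
Proof.
have [->|u0] := eqVneq u 0.
  exists (L x)%:P => [|t]; first by rewrite size_polyC; case: (_ == _).
  by rewrite scaler0 addr0 hornerC.
have [[t0 xt0]|nx] := pselect (exists t0, x + t0 *: u = 0).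
  exists (L u *: ('X - t0%:P) ^+ D) => [|t].
    by apply: leq_trans (size_scale_leq _ _) _; rewrite size_exp_XsubC.
  rewrite hornerZ horner_exp hornerXsubC mulrC -Lhom; congr L.
  by rewrite scalerBl -[x](addrK (t0 *: u)) xt0 sub0r addrC.
have lined t : differentiable (line x u) t.
  by apply: line_diff; apply/eqP => h; apply: nx; exists t.
have cont0 : {for 0, continuous (line u x)}.
  by apply: differentiable_continuous; apply: line_diff; rewrite scale0r addr0.
have [d d0 hd] := continuous_cmod cont0 (@ltr01 R).
apply: (@growth_poly R D.+1 (line x u) [::] (cmod (L u) + 1) (1 + d^-1)).
- by move=> t; apply: differentiable_continuous.
- by move=> t _; apply/derivable1_diffP.
move=> t ht; have d'0 : 0 < d^-1 by rewrite invr_gt0.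
have t0 : 0 < cmod t by lra.
have tn0 : t != 0 by rewrite -cmod_gt0.
rewrite exprSr mulrA; apply: ler_wpM2r; first exact: ltW.
have -> : line x u t = t ^+ D * line u x t^-1.
  rewrite /line -Lhom scalerDr scalerA divff // scale1r; congr L.
  by rewrite addrC.
rewrite cmodM cmodX mulrC; apply: ler_wpM2r; first by rewrite exprn_ge0 // ltW.
have /hd : cmod (t^-1 - 0) < d.
  by rewrite subr0 cmodV -[d]invrK ltf_pV2 ?posrE //; lra.
rewrite {2}/line scale0r addr0 => h.
have := cmodD (line u x t^-1 - L u) (L u); rewrite subrK; lra.
Qed.

Lemma homogeneous_function_mpoly : exists2 P : mpoly N C,
  P \is ishomog1 D mdeg & forall x : 'rV[C]_N, L x = meval (fun i => x 0 i) P.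
Proof.
have [|P hP] := @separately_poly _ N D.+1 L.
  move=> x i; have [p sp hp] :=
    line_poly (x - x 0 i *: delta_mx 0 i) (delta_mx 0 i).
  exists p => // t; rewrite -hp; congr L; apply/rowP => j.
  rewrite !mxE eqxx /= eq_sym; case: eqP => [->|_] /=;
    rewrite ?mulr1 ?mulr0 ?subr0 ?addr0 //.
  by rewrite subrr add0r.
exists (pihomog mdeg D P); first exact: pihomogP.
move=> x; rewrite hP; apply: (@meval_homog_component _ _ D) => v c.
have E w : meval w P = L (\row_i w i).
  by rewrite hP; apply: meval_eq => i; rewrite mxE.
by rewrite !E -Lhom; congr L; apply/rowP => i; rewrite !mxE.
Qed.

End HomogeneousFunctions.

(** * Multivariate polynomials over a field form a factorial ring *)

Section Univariate.
Variables (K : idomainType) (n : nat).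
Local Notation widen := (widen_ord (leqnSn n)).
Implicit Types (p : mpoly n.+1 K) (q : {poly (mpoly n K)}).

(** The inverse of [muni], which isolates the last variable; it transports results on {poly A} to
    one more variable. *)
Definition ofuni q : mpoly n.+1 K :=
  (map_poly (@mwiden n K) q).[mpolyX K (mnm1 ord_max)].

Lemma ofuniD : {morph ofuni : q q' / q + q'}.
Proof. by move=> q q'; rewrite /ofuni rmorphD hornerD. Qed.

Lemma ofuniM : {morph ofuni : q q' / q * q'}.
Proof. by move=> q q'; rewrite /ofuni rmorphM hornerM. Qed.

Lemma ofuniC c : ofuni c%:P = mwiden c.
Proof. by rewrite /ofuni map_polyC hornerC. Qed.

Lemma ofuniX : ofuni 'X = mpolyX K (mnm1 ord_max).
Proof. by rewrite /ofuni map_polyX hornerX. Qed.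

Lemma ofuniXn k : ofuni 'X^k = mpolyX K (mnm1 ord_max) ^+ k.
Proof. by rewrite /ofuni map_polyXn hornerXn. Qed.

Lemma muni_mon (m : multinom n.+1) : muni (mpolyX K m) =
  mpolyX K (Multinom [tuple m (widen i) | i < n]) *: 'X^(m ord_max).
Proof. by rewrite muniE msuppX big_seq1 mcoeffX eqxx scale1r. Qed.

Lemma ofuni_mon m : ofuni (muni (mpolyX K m)) = mpolyX K m.
Proof.
rewrite muni_mon -mul_polyC ofuniM ofuniC ofuniXn mwidenX [RHS]mpolyXE_id.
rewrite big_ord_recr /= mpolyXE_id big_ord_recr /=.
rewrite mnmwiden_ordmax expr0 mulr1; congr (_ * _); apply: eq_bigr => i _.
by rewrite mnmwiden_widen mnmE.
Qed.

Lemma muniK : cancel (@muni n K) ofuni.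
Proof.
elim/mpolyind => [|c m p _ _ IH]; first by rewrite muni0 /ofuni rmorph0 horner0.
rewrite muniD ofuniD; congr (_ + _) => //.
by rewrite muniZ -mul_polyC ofuniM ofuniC ofuni_mon mwidenC mul_mpolyC.
Qed.

Lemma muni_widen (c : mpoly n K) : muni (mwiden c) = c%:P.
Proof.
elim/mpolyind: c => [|c m p _ _ IH]; first by rewrite mwiden0 muni0 rmorph0.
rewrite mwidenD muniD IH mwidenZ muniZ mwidenX muni_mon mnmwiden_ordmax expr0.
rewrite alg_polyC polyCD -mul_polyC -polyCM mul_mpolyC;
  congr ((_ *: mpolyX K _)%:P + _).
by apply/mnmP => i; rewrite mnmE mnmwiden_widen.
Qed.

Lemma muni_max : muni (mpolyX K (mnm1 ord_max)) = 'X :> {poly (mpoly n K)}.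
Proof.
rewrite muni_mon mnm1E eqxx expr1 (_ : Multinom _ = mnm0) ?mpolyX0 ?scale1r //.
apply/mnmP => i; rewrite mnmE mnm1E mnm0E (_ : _ == _ = false) //.
by apply/eqP => /(congr1 val) /= h; have := ltn_ord i; rewrite -h ltnn.
Qed.

Lemma ofuniK : cancel ofuni (@muni n K).
Proof.
elim/poly_ind => [|q c IH]; first by rewrite /ofuni rmorph0 horner0 muni0.
by rewrite ofuniD ofuniM ofuniX ofuniC muniD muniM IH muni_max muni_widen.
Qed.

Lemma meval_mwiden (x : 'I_n.+1 -> K) (c : mpoly n K) :
  meval x (mwiden c) = meval (x \o widen) c.
Proof.
elim/mpolyind: c => [|c m p _ _ IH]; first by rewrite mwiden0 !meval0.
rewrite mwidenD !mevalD IH mwidenZ !mevalZ mwidenX !mevalX big_ord_recr /=.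
rewrite mnmwiden_ordmax expr0 mulr1; congr (_ * _ + _).
by apply: eq_bigr => i _; rewrite mnmwiden_widen.
Qed.

Lemma meval_ofuni (x : 'I_n.+1 -> K) q :
  meval x (ofuni q) = (map_poly (meval (x \o widen)) q).[x ord_max].
Proof.
have := horner_map (meval x) (map_poly (@mwiden n K) q) (mpolyX K (mnm1 ord_max)).
rewrite /= mevalXU /ofuni => <-; rewrite -map_poly_comp /=; congr _.[_].
by apply: eq_map_poly => c; exact: meval_mwiden.
Qed.

End Univariate.

Lemma mpoly_ext (K : numFieldType) n (p : mpoly n K) :
  (forall x, meval x p = 0) -> p = 0.
Proof.
elim: n p => [|n IH] p hp.
  rewrite [p]nvar0_mpolyC; have := hp (fun _ => 0).
  by rewrite [p]nvar0_mpolyC mevalC mcoeffC eqxx mulr1 => ->; rewrite mpolyC0.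
rewrite -[p]muniK; suff -> : muni p = 0 by rewrite /ofuni rmorph0 horner0.
apply/polyP => k; rewrite coef0; apply: IH => x.
suff E : map_poly (meval x) (muni p) = 0.
  by have := congr1 (fun q : {poly K} => q`_k) E; rewrite coef_map coef0.
apply: poly_ext => t; rewrite horner0.
pose y (i : 'I_n.+1) := if unlift ord_max i is Some j then x j else t.
rewrite -(hp y) -[in RHS](muniK p) meval_ofuni; congr _.[_]; last first.
  by rewrite /y unlift_none.
apply: eq_map_poly => c; apply: meval_eq => i.
rewrite /y /= (_ : widen_ord _ _ = lift ord_max i) ?liftK //.
by apply: val_inj; rewrite /= /bump leqNgt ltn_ord.
Qed.

Section Divisibility.
Variable A : idomainType.
Implicit Types a b c p : A.

Definition divides a b := exists c, b = c * a.

Definition prime_elt p :=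
  [/\ p != 0, p \isn't a GRing.unit & forall a b,
    divides p (a * b) -> divides p a \/ divides p b].

Lemma divides_mull p a b : divides p b -> divides p (a * b).
Proof. by move=> [c ->]; exists (a * c); rewrite mulrA. Qed.

Lemma divides_mulr p a b : divides p a -> divides p (a * b).
Proof. by rewrite mulrC; exact: divides_mull. Qed.

Lemma divides_add p a b : divides p a -> divides p b -> divides p (a + b).
Proof. by move=> [c ->] [c' ->]; exists (c + c'); rewrite mulrDl. Qed.

Lemma divides_opp p a : divides p a -> divides p (- a).
Proof. by move=> [c ->]; exists (- c); rewrite mulNr. Qed.

Lemma divides_sum p (I : Type) (r : seq I) (P : pred I) (F : I -> A) :
  (forall i, P i -> divides p (F i)) -> divides p (\sum_(i <- r | P i) F i).
Proof.
move=> h; elim/big_rec: _ => [|i x Pi]; first by exists 0; rewrite mul0r.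
by apply: divides_add; exact: h.
Qed.

End Divisibility.

(** * Gauss's lemma: irreducible polynomials over a factorial ring are prime *)

Section Gauss.
Variable A : idomainType.
Implicit Types a b c p : A.
Variable deg : A -> nat.
Hypothesis degM : forall a b, a != 0 -> b != 0 -> deg (a * b) = (deg a + deg b)%N.
Hypothesis deg0 : forall a, a != 0 -> deg a = 0%N -> a \is a GRing.unit.
Hypothesis irr_prime : forall p : A, irreducible_elt p -> prime_elt p.

(** Induction on [deg]: nonzero elements of degree 0 are units, so both factors of a proper
    factorization have smaller degree. *)
Lemma irreducible_factor c : c != 0 -> c \isn't a GRing.unit ->
  exists p c', [/\ prime_elt p, c = p * c' & (deg c' < deg c)%N].
Proof.
have [n] := ubnP (deg c); elim: n c => // n IH c cn c0 cu.
have [ic|nic] := pselect (irreducible_elt c).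
  exists c, 1; split; [exact: irr_prime|by rewrite mulr1|].
  have := degM (oner_neq0 A) (oner_neq0 A); rewrite mulr1 => d1.
  have : deg c != 0%N by apply: contraNneq cu => /(deg0 c0).
  rewrite -lt0n; move: d1; move: (deg 1) (deg c) => x y; lia.
have [a [b [cE au bu]]] : exists a b, [/\ c = a * b,
  a \isn't a GRing.unit & b \isn't a GRing.unit].
  apply: contrapT => h; apply: nic; split=> // a b E.
  have [|au] := boolP (a \is a GRing.unit); first by left.
  have [|bu] := boolP (b \is a GRing.unit); first by right.
  by case: h; exists a, b.
have a0 : a != 0 by apply: contraNneq c0 => a0; rewrite cE a0 mul0r.
have b0 : b != 0 by apply: contraNneq c0 => b0; rewrite cE b0 mulr0.
have da : deg a != 0%N by apply: contraNneq au => /(deg0 a0).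
have db : deg b != 0%N by apply: contraNneq bu => /(deg0 b0).
have dc := degM a0 b0; rewrite -cE in dc.
have an : (deg a < n)%N by rewrite -ltnS; apply: leq_trans cn;
  rewrite ltnS dc -[X in (X < _)%N]addn0 ltn_add2l lt0n.
have [p [c' [pp E l]]] := IH a an a0 au.
have c'0 : c' != 0 by apply: contraNneq a0 => h; rewrite E h mulr0.
by exists p, (c' * b); split; rewrite ?mulrA ?cE ?E // -E -cE degM // dc ltn_add2r.
Qed.

Lemma divides_polyC p (q : {poly A}) :
  divides p%:P q <-> forall k, divides p q`_k.
Proof.
split=> [[c ->] k|h]; first by exists c`_k; rewrite coefMC.
have /choice[c hc] := h; exists (\poly_(i < size q) c i).
apply/polyP => k; rewrite coefMC coef_poly; case: ltnP => [_|kq]; first exact: hc.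
by rewrite mul0r nth_default.
Qed.

Lemma not_dvd_polyC p (q : {poly A}) : ~ divides p%:P q ->
  exists i, ~ divides p q`_i /\ forall j, (j < i)%N -> divides p q`_j.
Proof.
move=> h; have [i ni] : exists i, ~ divides p q`_i.
  by apply: contrapT => h'; apply: h; apply/divides_polyC => k;
    apply: contrapT => nk; apply: h'; exists k.
have ex : exists i, `[< ~ divides p q`_i >] by exists i; apply/asboolP.
case: (ex_minnP ex) => m /asboolP hm min; exists m; split=> // j jm.
by apply: contrapT => /asboolP/min; rewrite leqNgt jm.
Qed.

(** If i and j are the first indices where p fails to divide the coefficients of q and r, then p
    divides every term of the coefficient i + j of q r except q_i r_j. *)
Lemma prime_polyC p (q r : {poly A}) : prime_elt p ->
  divides p%:P (q * r) -> divides p%:P q \/ divides p%:P r.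
Proof.
move=> [p0 pu pp] /divides_polyC h; apply: contrapT => /not_orP[].
move=> /not_dvd_polyC[i [ni hi]] /not_dvd_polyC[j [nj hj]].
have lt_i : (i < (i + j).+1)%N by rewrite ltnS leq_addr.
have := h (i + j)%N; rewrite coefM (bigD1 (Ordinal lt_i)) //= addKn => hd.
suff hs : divides p (\sum_(k < (i + j).+1 | k != Ordinal lt_i) q`_k * r`_(i + j -
  k)).
  have := divides_add hd (divides_opp hs); rewrite addrK => /pp[];
    [exact: ni|exact: nj].
apply: divides_sum => k; rewrite -val_eqE /= neq_ltn => /orP[ki|ik].
  by apply: divides_mulr; exact: hi.
by apply: divides_mull; apply: hj; have := ltn_ord k; lia.
Qed.

(** Content 1, expressed without gcds. *)
Definition primitive (f : {poly A}) := forall p, prime_elt p -> ~ divides p%:P f.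

(** The prime factors of c are cancelled one by one: if c g = q f, a prime factor of c divides q f,
    hence q since f is primitive. *)
Lemma primitive_cancel (f g : {poly A}) c : primitive f -> c != 0 ->
  divides f (c%:P * g) -> divides f g.
Proof.
move=> pf; have [n] := ubnP (deg c); elim: n c => // n IH c cn c0 [q E].
have [cu|cu] := boolP (c \is a GRing.unit).
  by exists (c^-1%:P * q); rewrite -mulrA -E mulrA -polyCM mulVr // mul1r.
have [p [c' [pp cE lc]]] := irreducible_factor c0 cu.
have p0 : p != 0 by case: pp.
have c'0 : c' != 0 by apply: contraNneq c0 => h; rewrite cE h mulr0.
have : divides p%:P (q * f).
  by exists (c'%:P * g); rewrite -E cE polyCM -mulrA mulrC.
move=> /(prime_polyC pp)[[q' qE]|/(pf p pp)[]].
apply: (IH c') => //; first by apply: leq_trans lc _.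
exists q'; have h : p%:P * (c'%:P * g) = p%:P * (q' * f).
  by rewrite mulrA -polyCM -cE E qE mulrA [p%:P * q']mulrC.
by apply: mulfI h; rewrite polyC_eq0.
Qed.

(** Each prime constant that is extracted lowers the degree of the leading coefficient, so the
    process ends. *)
Lemma primitive_part (w : {poly A}) : w != 0 ->
  exists c w', [/\ c != 0, primitive w' & w = c%:P * w'].
Proof.
have [n] := ubnP (deg (lead_coef w)); elim: n w => // n IH w wn w0.
have [pw|npw] := pselect (primitive w).
  by exists 1, w; rewrite oner_neq0 mul1r.
have [p [pp [v E]]] : exists p, prime_elt p /\ divides p%:P w.
  by apply: contrapT => h; apply: npw => p pp hp; apply: h; exists p.
have v0 : v != 0 by apply: contraNneq w0 => h; rewrite E h mul0r.
have [p0 pu _] := pp.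
have lE : lead_coef w = lead_coef v * p by rewrite E lead_coefM lead_coefC.
have [||c [w' [c0 pw' vE]]] := IH v => //.
  have dp : deg p != 0%N by apply: contraNneq pu => /(deg0 p0).
  rewrite lE degM ?lead_coef_eq0 // ltnS in wn; apply: leq_trans wn.
  by rewrite -[X in (X < _)%N]addn0 ltn_add2l lt0n.
by exists (p * c), w'; rewrite mulf_neq0 // polyCM -mulrA -vE mulrC.
Qed.

Lemma irreducible_primitive (f : {poly A}) : irreducible_elt f -> (1 < size f)%N ->
  primitive f.
Proof.
move=> [f0 fu fi] sf p [p0 pu _] [c E]; have [cu|pu'] := fi _ _ E.
  move: cu; rewrite poly_unitE => /andP[/eqP sc _].
  by move: sf; rewrite E mulrC size_Cmul // sc.
by move: pu'; rewrite poly_unitE coefC eqxx (negbTE pu) andbF.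
Qed.

(* A combination of f and g of least size divides both up to a constant, by
   pseudo-division, and so does its primitive part. *)
Lemma bezout_irreducible (f g : {poly A}) : irreducible_elt f -> (1 < size f)%N ->
  ~ divides f g -> exists u v r, r != 0 /\ u * f + v * g = r%:P.
Proof.
move=> fi sf nfg; have [f0 fu fU] := fi.
pose I (w : {poly A}) := w != 0 /\ exists u v, w = u * f + v * g.
have exI : exists k, `[< exists w, I w /\ size w = k >].
  exists (size f); apply/asboolP; exists f; split=> //; split=> //.
  by exists 1, 0; rewrite mul1r mul0r addr0.
case: (ex_minnP exI) => m /asboolP[w [[w0 [u [v wE]]] wm]] min.
have wdvd h : (exists u v, h = u * f + v * g) ->
    exists k, divides w ((lead_coef w ^+ k)%:P * h).
  move=> [u' [v' hE]]; exists (scalp h w).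
  have E := Pdiv.WeakIdomain.divp_eq h w.
  have [r0|rn0] := eqVneq (modp h w) 0.
    by exists (divp h w); rewrite mul_polyC E r0 addr0.
  have : `[< exists w', I w' /\ size w' = size (modp h w) >].
    apply/asboolP; exists (modp h w); split=> //; split=> //.
    exists ((lead_coef w ^+ scalp h w) *: u' - divp h w * u).
    exists ((lead_coef w ^+ scalp h w) *: v' - divp h w * v).
    have -> : modp h w = (lead_coef w ^+ scalp h w) *: h - divp h w * w.
      by rewrite E addrAC subrr add0r.
    rewrite -!mul_polyC; move: (_ ^+ _)%:P (divp h w) => l q.
    by rewrite hE wE; ring.
  by move/min; rewrite leqNgt -wm Pdiv.CommonIdomain.ltn_modpN0.
have lw k : lead_coef w ^+ k != 0 by rewrite expf_neq0 // lead_coef_eq0.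
have [c [w' [c0 pw' wE']]] := primitive_part w0.
have w'divides h : (exists u v, h = u * f + v * g) -> divides w' h.
  move=> /wdvd[k hk]; apply: primitive_cancel (lw k) _ => //.
  by case: hk => q ->; exists (q * c%:P); rewrite wE' mulrA.
have w'f : divides w' f by apply: w'divides; exists 1, 0; rewrite mul1r mul0r addr0.
have w'g : divides w' g by apply: w'divides; exists 0, 1; rewrite mul1r mul0r add0r.
have [sw|sw] := leqP (size w) 1.
  exists u, v, w`_0; rewrite -wE -size1_polyC //; split=> //.
  by apply: contraNneq w0 => h; rewrite [w]size1_polyC // h.
(* Otherwise w' is a nonconstant common divisor; irreducibility of f makes the cofactor s a unit,
   and f would divide g. *)
case: nfg; case: w'f => s fE; have [su|w'u] := fU _ _ fE.
  case: w'g => t ->; exists (t * s^-1); rewrite fE mulrA.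
  by rewrite -(mulrA t) mulVr // mulr1.
move: w'u; rewrite poly_unitE => /andP[/eqP sw' _].
by move: sw; rewrite wE' size_Cmul // sw'.
Qed.

Lemma irreducible_polyC_inv p : irreducible_elt p%:P -> irreducible_elt p.
Proof.
rewrite /irreducible_elt polyC_eq0 poly_unitE coefC eqxx => -[p0 pu pU].
rewrite size_polyC p0 /= in pu; split=> // a b ab; have := pU a%:P b%:P.
by rewrite -polyCM -ab !poly_unitE !coefC eqxx => /(_ erefl)[] /andP[]; auto.
Qed.

(** Constants are handled by Gauss's lemma. Otherwise, if f does not divide g, then u f + v g = r
    with r a nonzero constant; so f divides r h, and r cancels because f is primitive. *)
Lemma irreducible_poly_prime (f : {poly A}) : irreducible_elt f -> prime_elt f.
Proof.
move=> fi; have [f0 fu fU] := fi; split=> // g h fgh.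
have [sf|sf] := leqP (size f) 1.
  rewrite (size1_polyC sf) in fgh fi *; apply: prime_polyC => //.
  exact/irr_prime/irreducible_polyC_inv.
have [|nfg] := pselect (divides f g); first by left.
have [u [v [r [r0 E]]]] := bezout_irreducible fi sf nfg.
right; apply: (primitive_cancel (irreducible_primitive fi sf) r0).
rewrite -E mulrDl; apply: divides_add; last by rewrite -mulrA; exact: divides_mull.
by rewrite mulrAC; apply: divides_mull; exists 1; rewrite mul1r.
Qed.

End Gauss.

Section Factorial.
Variable K : fieldType.

Lemma mpoly_unit_const n (p : mpoly n K) : p != 0 -> (mmeasure mdeg p).-1 = 0%N ->
  p \is a GRing.unit.
Proof.
move=> p0 dp; have /msize_poly1P[c c0 ->] : mmeasure mdeg p == 1%N.
  by rewrite mpolySpred // dp.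
by apply/unitrP; exists (mpolyC n c^-1); rewrite -!mpolyCM mulVf ?mulfV // mpolyC1.
Qed.

Lemma mpoly_degM n (p q : mpoly n K) : p != 0 -> q != 0 ->
  (mmeasure mdeg (p * q)).-1 = ((mmeasure mdeg p).-1 + (mmeasure mdeg q).-1)%N.
Proof.
move=> p0 q0; rewrite msizeM // (mpolySpred mdeg p0) (mpolySpred mdeg q0).
by rewrite addnS.
Qed.

Lemma muni_unit n (p : mpoly n.+1 K) : (muni p \is a GRing.unit) = (p \is a
  GRing.unit).
Proof.
apply/idP/idP => [u|]; last exact: rmorph_unit.
apply/unitrP; exists (ofuni (muni p)^-1); rewrite -{2 3}[p]muniK -!ofuniM.
by rewrite mulVr ?mulrV // ofuniC mwiden1.
Qed.

Lemma muni_eq0 n (p : mpoly n.+1 K) : (muni p == 0) = (p == 0).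
Proof. by rewrite -(inj_eq (can_inj (@muniK _ _))) muni0. Qed.

Lemma muni_irreducible n (p : mpoly n.+1 K) : irreducible_elt p ->
  irreducible_elt (muni p).
Proof.
move=> [p0 pu pU]; split; rewrite ?muni_eq0 ?muni_unit // => a b ab.
have E : p = ofuni a * ofuni b by rewrite -ofuniM -ab muniK.
by case: (pU _ _ E) => h; [left|right]; rewrite -muni_unit ofuniK in h.
Qed.

Lemma divides_muni n (p q : mpoly n.+1 K) : divides p q <-> divides (muni p)
  (muni q).
Proof.
split=> [[c ->]|[c E]]; first by exists (muni c); rewrite muniM.
by exists (ofuni c); rewrite -[q]muniK E ofuniM muniK.
Qed.

(** Induction on n through [muni], with the total degree as [deg]; in 0 variables every nonzero
    polynomial is a unit. *)
Lemma irreducible_mpoly_prime n (f : mpoly n K) : irreducible_elt f -> prime_elt f.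
Proof.
elim: n f => [f [f0 fu _]|n IH f fi].
  case/negP: fu; apply: mpoly_unit_const => //.
  by rewrite [f]nvar0_mpolyC msizeC; case: (_ != _).
have [f0 fu _] := fi; split=> // a b; rewrite !divides_muni muniM.
have [_ _] := irreducible_poly_prime (@mpoly_degM n) (@mpoly_unit_const n) (@IH)
  (muni_irreducible fi).
exact.
Qed.

End Factorial.

Lemma common_root (A B : idomainType) (phi : {rmorphism A -> B})
    (u v F G : {poly A}) (r : A) t :
  u * F + v * G = r%:P -> (map_poly phi F).[t] = 0 -> (map_poly phi G).[t] = 0 ->
  phi r = 0.
Proof.
move=> E F0 G0; rewrite -[LHS](hornerC _ t) -map_polyC -E.
by rewrite rmorphD !rmorphM hornerD !hornerM F0 G0 !mulr0 addr0.
Qed.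

(** If f involves the last variable, the other variables are given values where neither the leading
    coefficient of f nor the constant r of u f + v g = r vanishes; f then has a root in the last
    variable, which is no root of g. Otherwise the induction applies to f and a coefficient of g
    that f does not divide. *)
Lemma irreducible_nullstellensatz (K : numClosedFieldType) n (f g : mpoly n K) :
  irreducible_elt f -> ~ divides f g -> exists2 x, meval x f = 0 & meval x g != 0.
Proof.
elim: n f g => [f g [f0 fu _]|n IH f g fi nfg].
  case/negP: fu; apply: mpoly_unit_const => //.
  by rewrite [f]nvar0_mpolyC msizeC; case: (_ != _).
have nonzero m (r : mpoly m K) : r != 0 -> exists x, meval x r != 0.
  move=> r0; apply: contrapT => h; case/eqP: r0; apply: mpoly_ext => x.
  by apply/eqP; apply: contrapT => /negP hx; apply: h; exists x.
pose ext (x : 'I_n -> K) t (i : 'I_n.+1) :=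
  if unlift ord_max i is Some j then x j else t.
have extE x t (p : mpoly n.+1 K) : meval (ext x t) p = (map_poly (meval x) (muni
  p)).[t].
  rewrite -{1}[p]muniK meval_ofuni {2}/ext unlift_none; congr _.[_].
  apply: eq_map_poly => c; apply: meval_eq => i.
  rewrite /ext /= (_ : widen_ord _ _ = lift ord_max i) ?liftK //.
  by apply: val_inj; rewrite /= /bump leqNgt ltn_ord.
have Fi := muni_irreducible fi;
  have nFG : ~ divides (muni f) (muni g) by rewrite -divides_muni.
have [sF|sF] := leqP (size (muni f)) 1.
  have FE := size1_polyC sF; rewrite FE in Fi nFG.
  have ci := irreducible_polyC_inv Fi.
  have [k [nk _]] := not_dvd_polyC nFG.
  have [x fx gx] := IH _ _ ci nk.
  have [t gt] : exists t, (map_poly (meval x) (muni g)).[t] != 0.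
    apply: contrapT => h; case/eqP: gx; rewrite -coef_map.
    rewrite [map_poly _ _](_ : _ = 0) ?coef0 //; apply: poly_ext => t;
      rewrite horner0.
    by apply/eqP; apply: contrapT => /negP ht; apply: h; exists t.
  by exists (ext x t); rewrite extE // FE map_polyC hornerC.
have [u [v [r [r0 E]]]] := bezout_irreducible (@mpoly_degM K n)
  (@mpoly_unit_const K n)
  (@irreducible_mpoly_prime K n) Fi sF nFG.
have F0 : muni f != 0 by case: Fi.
have [x] : exists x, meval x (r * lead_coef (muni f)) != 0.
  by apply: nonzero; rewrite mulf_neq0 // lead_coef_eq0.
rewrite mevalM mulf_eq0 negb_or => /andP[rx lx].
have /closed_rootP[t /eqP ft] : size (map_poly (meval x) (muni f)) != 1%N.
  by rewrite size_map_poly_id0 // gtn_eqF.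
exists (ext x t); rewrite extE //.
apply: contraNneq rx => gt; apply/eqP.
exact: common_root E ft gt.
Qed.

(** * Wronskians and first integrals *)

Section Wronskian.
Variables (A : idomainType) (X : A -> A).
Hypothesis XD : {morph X : a b / a + b}.
Hypothesis XM : forall a b, X (a * b) = X a * b + a * X b.
Implicit Types (f g : nat -> A).

(** The family [g] is indexed by [nat], so that the same g serves for Wronskians of all sizes. *)
Definition wronskian_mx r g : 'M[A]_r := \matrix_(a, b) iter a X (g b).
Definition wronskian r g : A := \det (wronskian_mx r g).

Lemma derivation0 : X 0 = 0.
Proof. by apply: (@addIr _ (X 0)); rewrite -XD !add0r. Qed.

Lemma derivation_sum (I : Type) (s : seq I) (P : pred I) (F : I -> A) :
  X (\sum_(i <- s | P i) F i) = \sum_(i <- s | P i) X (F i).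
Proof. by elim/big_rec2: _ => [|i x y _ <-]; rewrite ?derivation0 ?XD. Qed.

Lemma iter_derivation_lin k m (c : 'I_m -> A) (F : 'I_m -> A) :
  (forall i, X (c i) = 0) ->
  iter k X (\sum_i c i * F i) = \sum_i c i * iter k X (F i).
Proof.
move=> Xc; elim: k => //= k ->; rewrite derivation_sum; apply: eq_bigr => i _.
by rewrite XM Xc mul0r add0r.
Qed.

Lemma iter_derivation_divides p k : divides p (X p) -> divides p (iter k X p).
Proof.
move=> [h hE]; elim: k => [|k [q IH]] /=; first by exists 1; rewrite mul1r.
by exists (X q + q * h); rewrite IH XM hE mulrDl mulrA.
Qed.

Lemma invariant_divides_wronskian r g (c : 'I_r -> A) p i :
  (forall i, X (c i) = 0) -> c i \is a GRing.unit -> p = \sum_j c j * g j ->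
  divides p (X p) -> divides p (wronskian r g).
Proof.
move=> Xc ci pE pX.
have E : wronskian r g * c i = \sum_a (\adj (wronskian_mx r g)) i a * iter a X p.
  have /matrixP/(_ i 0) := congr1 (mulmx^~ (\col_j c j)) (mul_adj_mx
    (wronskian_mx r g)).
  rewrite -mulmxA mul_scalar_mx !mxE => <-; apply: eq_bigr => a _; congr (_ * _).
  rewrite mxE pE iter_derivation_lin //; apply: eq_bigr => j _.
  by rewrite !mxE mulrC.
have : divides p (wronskian r g * c i).
  by rewrite E; apply: divides_sum => a _; apply: divides_mull;
    exact: iter_derivation_divides.
by move=> [q qE]; exists (q * (c i)^-1); rewrite mulrAC -qE mulrK.
Qed.

Lemma det_mulmx_eq0 r (B : 'M[A]_r) (v : 'cV[A]_r) : \det B != 0 -> B *m v = 0 ->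
  v = 0.
Proof.
move=> dB Bv; have := congr1 (mulmx (\adj B)) Bv.
rewrite mulmxA mul_adj_mx mul_scalar_mx mulmx0 => /colP h.
apply/colP => i; have := h i; rewrite !mxE => /eqP.
by rewrite mulf_eq0 (negbTE dB) => /eqP.
Qed.

(** The Wronskians of these families are the numerators P_b in Cramer's rule. *)
Definition subst_col r (b : nat) g : nat -> A :=
  fun c => g (if c == b then r else c).

Lemma cramer_wronskian r g :
  wronskian_mx r g *m (\col_b wronskian r (subst_col r b g)) =
  wronskian r g *: (\col_a iter a X (g r)).
Proof.
have -> : \col_b wronskian r (subst_col r b g) =
    \adj (wronskian_mx r g) *m (\col_(a < r) iter a X (g r)).
  apply/colP => b; rewrite !mxE /wronskian (expand_det_col _ b).
  apply: eq_bigr => a _; rewrite !mxE /subst_col eqxx mulrC; congr (_ * _).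
  rewrite /cofactor; congr (_ * \det _); apply/matrixP => i j; rewrite !mxE.
  by rewrite (_ : (_ == _) = false) //; apply/negbTE; rewrite eq_sym;
    exact: neq_lift.
by rewrite mulmxA mul_mx_adj mul_scalar_mx.
Qed.

(** Cramer's rule gives the rows a < r. For a = r, take a kernel vector v of the singular matrix of
    size r + 1: the first r rows give Q v_b = - v_r P_b with v_r nonzero, and the last row of the
    kernel equation is the relation. *)
Lemma singular_wronskian_relation r g :
  wronskian r g != 0 -> wronskian r.+1 g = 0 -> forall a, (a <= r)%N ->
  wronskian r g * iter a X (g r) =
  \sum_(b < r) wronskian r (subst_col r b g) * iter a X (g b).
Proof.
move=> Q0 sing a; rewrite leq_eqVlt => /predU1P[->{a}|ar]; last first.
  have /matrixP/(_ (Ordinal ar) 0) := cramer_wronskian r g; rewrite !mxE /= => <-.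
  by apply: eq_bigr => b _; rewrite !mxE mulrC.
have /det0P[v' v'0 hv'] : \det (wronskian_mx r.+1 g)^T == 0
  by rewrite det_tr -/(wronskian _ _) sing.
pose v (b : nat) := v' 0 (inord b); pose Q := wronskian r g.
have vE (b : 'I_r.+1) : v' 0 b = v b by rewrite /v inord_val.
have hv c : (c <= r)%N -> \sum_(b < r) iter c X (g b) * v b + iter c X (g r) * v
  r = 0.
  move=> cr; have /matrixP/(_ 0 (Ordinal (cr : (c < r.+1)%N))) := hv'.
  rewrite !mxE big_ord_recr /= !mxE vE /= [v r * _]mulrC => H; rewrite -[RHS]H;
    congr (_ + _).
  by apply: eq_bigr => b _; rewrite vE !mxE mulrC.
pose w : 'cV[A]_r := \col_b (Q * v b + v r * wronskian r (subst_col r b g)).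
have w0 : w = 0.
  apply: (det_mulmx_eq0 Q0);
    have -> : w = Q *: (\col_b v b) + v r *: (\col_b wronskian r (subst_col r b g)).
    by apply/colP => b; rewrite !mxE.
  rewrite mulmxDr -!scalemxAr cramer_wronskian scalerA [v r * _]mulrC -scalerA
    -scalerDr.
  rewrite (_ : _ + _ = 0) ?scaler0 //; apply/colP => c; rewrite !mxE.
  rewrite -[RHS](hv c (ltnW (ltn_ord c))) [v r * _]mulrC; congr (_ + _).
  by apply: eq_bigr => b _; rewrite !mxE.
have hw (b : 'I_r) : Q * v b = - (v r * wronskian r (subst_col r b g)).
  by have /colP/(_ b) := w0; rewrite !mxE => /eqP; rewrite addr_eq0 => /eqP.
have vr0 : v r != 0.
  apply: contraNneq v'0 => vr0; apply/eqP/rowP => b; rewrite mxE vE.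
  have := ltn_ord b; rewrite ltnS leq_eqVlt => /predU1P[->//|br].
  have := hw (Ordinal br); rewrite vr0 mul0r oppr0 => /eqP.
  by rewrite mulf_eq0 (negbTE Q0) => /eqP.
apply: (mulfI vr0); have := congr1 ( *%R Q) (hv r (leqnn _)).
rewrite mulr0 mulrDr mulr_sumr => /eqP; rewrite addrC addr_eq0 => /eqP.
rewrite -/Q => H.
rewrite (_ : v r * (Q * iter r X (g r)) = Q * (iter r X (g r) * v r)); last by ring.
rewrite H mulr_sumr -sumrN; apply: eq_bigr => b _.
by rewrite mulrCA hw mulrN opprK; ring.
Qed.

(* Apply X to Q X^a g_r = sum_b P_b X^a g_b and compare with the same relation for
   a + 1. *)
Lemma first_integrals_of_wronskian r g :
  wronskian r g != 0 -> wronskian r.+1 g = 0 -> forall b : 'I_r,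
  X (wronskian r g) * wronskian r (subst_col r b g) =
  X (wronskian r (subst_col r b g)) * wronskian r g.
Proof.
move=> Q0 sing; pose Q := wronskian r g.
pose P (b : 'I_r) := wronskian r (subst_col r b g).
have I a : (a <= r)%N -> Q * iter a X (g r) = \sum_(b < r) P b * iter a X (g b).
  exact: singular_wronskian_relation.
have J a : (a < r)%N -> X Q * iter a X (g r) = \sum_(b < r) X (P b) * iter a X (g
  b).
  move=> ar; apply: (@addIr _ (Q * iter a.+1 X (g r))).
  rewrite -[LHS]XM (I a (ltnW ar)) (I _ ar) -big_split derivation_sum.
  by apply: eq_bigr => b _; rewrite XM.
pose w : 'cV[A]_r := \col_b (X Q * P b - X (P b) * Q).
(* By I and J, w is in the kernel of [wronskian_mx r g], whose determinant is nonzero. *)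
suff /colP h : w = 0.
  by move=> b; have := h b; rewrite !mxE => /eqP; rewrite subr_eq0 => /eqP.
apply: (det_mulmx_eq0 Q0); apply/colP => a; rewrite !mxE.
rewrite (eq_bigr (fun b : 'I_r =>
  X Q * (P b * iter a X (g b)) - Q * (X (P b) * iter a X (g b)))).
  by rewrite sumrB -!mulr_sumr -I ?(ltnW (ltn_ord a)) // -J // mulrCA subrr.
by move=> b _; rewrite !mxE; ring.
Qed.

Lemma first_singular_wronskian M g : g 0%N != 0 -> wronskian M g = 0 ->
  exists2 r, (r < M)%N & wronskian r g != 0 /\ wronskian r.+1 g = 0.
Proof.
move=> g0; elim: M => [|M IH] sM.
  by move: sM; rewrite /wronskian det_mx00 => /eqP; rewrite oner_eq0.
have [/IH[r rM h]|nz] := eqVneq (wronskian M g) 0; last by exists M.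
by exists r => //; exact: ltnW.
Qed.

End Wronskian.

(** * Homogeneous vector fields and the degree count *)

Section HomogeneousField.
Variables (K : numClosedFieldType) (n : nat).
Local Notation P := (mpoly n K).
Implicit Types p q : P.

Lemma homog_msizeE d p : p != 0 -> p \is ishomog1 d mdeg -> mmeasure mdeg p = d.+1.
Proof. by move=> p0 /dhomogP hp; rewrite -mlead_deg // hp // mlead_supp. Qed.

Lemma homog_mderiv d i p : p \is ishomog1 d.+1 mdeg ->
  mderiv i p \is ishomog1 d mdeg.
Proof.
move=> /dhomogP hp; apply/dhomogP => m.
rewrite mcoeff_msupp mcoeff_deriv mulrn_eq0 negb_or /= -mcoeff_msupp => /hp.
by rewrite -[LHS]/(mdeg (mnm_add m (mnm1 i))) mdegD mdeg1 addn1 => -[<-].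
Qed.

Lemma homog0_const p : p \is ishomog1 0 mdeg -> p = mpolyC n (mcoeff mnm0 p).
Proof.
move=> /dhomogP hp; apply: msize1_polyC; rewrite msizeE; apply/bigmax_leqP_seq.
by move=> m /hp ->.
Qed.

Variable (Xv : 'I_n -> P).

Definition field_deriv p : P := \sum_i Xv i * mderiv i p.

Lemma field_derivD : {morph field_deriv : p q / p + q}.
Proof.
move=> p q; rewrite /field_deriv -big_split; apply: eq_bigr => i _.
by rewrite mderivD mulrDr.
Qed.

Lemma field_derivM p q : field_deriv (p * q) = field_deriv p * q + p *
  field_deriv q.
Proof.
rewrite /field_deriv mulr_suml mulr_sumr -big_split; apply: eq_bigr => i _ /=.
by rewrite mderivM mulrDr; congr (_ + _); [exact: mulrA|exact: mulrCA].
Qed.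

Lemma field_derivC c : field_deriv (mpolyC n c) = 0.
Proof. by apply: big1 => i _; rewrite mderivC mulr0. Qed.

Variable (dl : nat).
Hypothesis Xv_homog : forall i, Xv i \is ishomog1 dl.+1 mdeg.

Lemma homog_field_deriv d p : p \is ishomog1 d mdeg ->
  field_deriv p \is ishomog1 (d + dl) mdeg.
Proof.
case: d => [/homog0_const ->|d hp]; first by rewrite field_derivC rpred0.
apply: rpred_sum => i _; have ->
  : (d.+1 + dl = dl.+1 + d)%N by rewrite addnC addnS addSn.
by apply: dhomogM => //; exact: homog_mderiv.
Qed.

Lemma homog_iter_field_deriv a d p : p \is ishomog1 d mdeg ->
  iter a field_deriv p \is ishomog1 (d + a * dl) mdeg.
Proof.
move=> hp; elim: a => [|a IH]; first by rewrite addn0.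
by rewrite iterS mulSn addnCA addnC; exact: homog_field_deriv.
Qed.

Lemma homog_det r (M : 'M[P]_r) (e : 'I_r -> nat) :
  (forall a b, M a b \is ishomog1 (e a) mdeg) ->
  \det M \is ishomog1 (\sum_a e a)%N mdeg.
Proof.
move=> hM; apply: rpred_sum => s _; rewrite mulr_sign.
case: ifP => _; rewrite ?rpredN; elim/big_rec2: _ => [|i y x _ hx];
  by [exact: dhomog1|exact: dhomogM].
Qed.

(** Row a has degree k + a dl, where dl is the degree of the field minus one, and the a < r sum to
    ['C(r, 2)]: this is the origin of the iterated binomial in the theorem. *)
Lemma homog_wronskian k r g : (forall c, g c \is ishomog1 k mdeg) ->
  wronskian field_deriv r g \is ishomog1 (k * r + dl * 'C(r, 2))%N mdeg.
Proof.
move=> hg; have -> : (k * r + dl * 'C(r, 2) = \sum_(a < r) (k + a * dl))%N.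
  rewrite big_split /= sum_nat_const card_ord -big_distrl /=.
  by congr (_ + _)%N; rewrite mulnC // -bin2_sum big_mkord.
by apply: homog_det => a b; rewrite mxE; exact: homog_iter_field_deriv.
Qed.

Lemma prime_divides_prod (A : idomainType) (p : A) (I : Type) (s : seq I) (F : I
  -> A) :
  prime_elt p -> divides p (\prod_(i <- s) F i) -> exists i, divides p (F i).
Proof.
move=> [p0 pu pp]; elim: s => [|i s IH].
  rewrite big_nil => -[c E]; case/negP: pu; apply/unitrP; exists c.
  by rewrite -E mulrC -E.
by rewrite big_cons => /pp[h|/IH//]; exists i.
Qed.

Lemma prod_irreducible_divides N (f : 'I_N -> P) W :
  (forall i, irreducible_elt (f i)) -> (forall i j,
    i != j -> ~ divides (f i) (f j)) ->
  (forall i, divides (f i) W) -> divides (\prod_i f i) W.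
Proof.
move=> fi fij; elim: N f fi fij => [|N IH] f fi fij fW.
  by rewrite big_ord0; exists W; rewrite mulr1.
have [||q E] := IH (fun i => f (widen_ord (leqnSn N) i)) (fun i => fi _).
- by move=> i j ij; apply: fij; rewrite -val_eqE.
- by move=> i; exact: fW.
have pm := irreducible_mpoly_prime (fi ord_max).
have := fW ord_max; have [_ _ pp] := pm; rewrite E => /pp[[c cE]|].
  by exists c; rewrite cE big_ord_recr /= mulrA mulrAC.
move=> h; have [i /fij[]] := prime_divides_prod pm h; rewrite -val_eqE /= neq_ltn.
by rewrite (ltn_ord i) orbT.
Qed.

Lemma first_integral_of_invariant_forms k M N (s : seq (multinom n)) (f : 'I_N ->
  P) :
  uniq s -> size s = M -> (forall m, (mdeg m == k) = (m \in s)) ->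
  (forall i, f i \is ishomog1 k mdeg) -> (forall i, irreducible_elt (f i)) ->
  (forall i j, i != j -> ~ divides (f i) (f j)) ->
  (forall i, divides (f i) (field_deriv (f i))) ->
  (0 < M)%N -> (k * M + dl * 'C(M, 2) < N * k)%N ->
  exists e p q, [/\ p \is ishomog1 e mdeg, q \is ishomog1 e mdeg, q != 0,
    forall c, p != c *: q & field_deriv q * p = field_deriv p * q].
Proof.
move=> us sM sk fk fi fij fX M0 lt_deg.
(* Indices beyond M fall back on the first monomial, so that every g b has degree k. *)
pose g (b : nat) : P := mpolyX K (nth mnm0 s (if (b < M)%N then b else 0)).
have nth_s b : nth mnm0 s (if (b < M)%N then b else 0) \in s.
  by apply: mem_nth; rewrite sM; case: (ltnP b M).
have gk b : g b \is ishomog1 k mdeg by rewrite dhomogX sk; exact: nth_s.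
pose X := field_deriv.
have fdvd i : divides (f i) (wronskian X M g).
  have [f0 _ _] := fi i.
  pose c (b : 'I_M) : P := mpolyC n (mcoeff (nth mnm0 s b) (f i)).
  have fE : f i = \sum_b c b * g b.
    rewrite [LHS]mpolyE (eq_bigr (fun m =>
      mpolyC n (mcoeff m (f i)) * mpolyX K m)); last first.
      by move=> m _; rewrite mul_mpolyC.
    rewrite (eq_bigr (fun b : 'I_M =>
      mpolyC n (mcoeff (nth mnm0 s b) (f i)) * mpolyX K (nth mnm0 s b)));
        last first.
      by move=> b _; rewrite /c /g ltn_ord.
    rewrite -(big_mkord xpredT (fun b =>
      mpolyC n (mcoeff (nth mnm0 s b) (f i)) * mpolyX K (nth mnm0 s b))).
    rewrite -sM -(big_nth mnm0 xpredT (fun m =>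
      mpolyC n (mcoeff m (f i)) * mpolyX K m)).
    rewrite [RHS](bigID (mem (msupp (f i)))) /= [X in _ + X]big1 ?addr0; last first.
      by move=> m /memN_msupp_eq0 ->; rewrite mpolyC0 mul0r.
    rewrite -[RHS]big_filter; apply: perm_big; apply: uniq_perm;
      rewrite ?msupp_uniq ?filter_uniq //.
    move=> m; rewrite mem_filter -sk; apply/idP/andP => [h|[]//]; split=> //.
    by apply/eqP; exact: (dhomog_mf (fk i)).
  have [b cb] : exists b, mcoeff (nth mnm0 s (b : 'I_M)) (f i) != 0.
    apply: contrapT => h; case/eqP: f0; rewrite fE big1 // => b _.
    rewrite /c; have [->|nz] := eqVneq (mcoeff (nth mnm0 s b) (f i)) 0.
      by rewrite mpolyC0 mul0r.
    by case: h; exists b.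
  apply: (@invariant_divides_wronskian _ X field_derivD field_derivM M g c (f i)
    b) => //.
    by move=> b'; exact: field_derivC.
  by apply/unitrP; exists (mpolyC n (mcoeff (nth mnm0 s b) (f i))^-1);
    rewrite -!mpolyCM mulVf ?mulfV // mpolyC1.
have W0 : wronskian X M g = 0.
  apply/eqP; apply: contraTT lt_deg => W0; rewrite -leqNgt.
  have [q E] := prod_irreducible_divides fi fij fdvd.
  have F0 : \prod_i f i != 0 by apply: contraNneq W0 => F0; rewrite E F0 mulr0.
  have q0 : q != 0 by apply: contraNneq W0 => q0; rewrite E q0 mul0r.
  have hF : \prod_i f i \is ishomog1 (N * k) mdeg.
    rewrite -[N in (N * k)%N]card_ord -sum_nat_const.
    by elim/big_rec2: _ => [|i y x _ hx]; [exact: dhomog1|exact: dhomogM].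
  have hW := homog_msizeE W0 (homog_wronskian M gk).
  have := mpoly_degM q0 F0; rewrite -E hW (homog_msizeE F0 hF) /= => ->.
  exact: leq_addl.
have g0 : g 0%N != 0.
  by apply/eqP => /(congr1 (@mmeasure n K mdeg)); rewrite msizeX mmeasure0.
have [r rM [Q0 S0]] := first_singular_wronskian g0 W0.
pose Q := wronskian X r g; pose p (b : 'I_r) := wronskian X r (subst_col r b g).
have rel := singular_wronskian_relation Q0 S0 (leq0n r).
(* If every P_b were a constant multiple of Q, the relation for a = 0 would make the monomial g r a
   linear combination of other monomials. *)
have [b pb] : exists b, forall c, p b != c *: Q.
  apply: contrapT => h.
  have /choice[c cE] : forall b : 'I_r, exists c, p b = c *: Q.
    move=> b; apply: contrapT => nb; apply: h; exists b => c.
    by apply/eqP => E; apply: nb; exists c.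
  have /(mulfI Q0) E : Q * g r = Q * \sum_(b < r) c b *: g b.
    rewrite [LHS]rel mulr_sumr; apply: eq_bigr => b _.
    by rewrite /= -/(p b) cE -scalerAl -scalerAr.
  have := congr1 (mcoeff (nth mnm0 s r)) E.
  rewrite /g rM mcoeffX eqxx raddf_sum big1 => [/eqP|b _];
    first by rewrite oner_eq0.
  have bM := ltn_trans (ltn_ord b) rM.
  rewrite /= bM mcoeffZ mcoeffX nth_uniq ?sM // (ltn_eqF (ltn_ord b)) mulr0 //.
have hp : p b \is ishomog1 (k * r + dl * 'C(r, 2))%N mdeg.
  by apply: homog_wronskian => c; exact: gk.
have hQ : Q \is ishomog1 (k * r + dl * 'C(r, 2))%N mdeg by exact: homog_wronskian.
exists (k * r + dl * 'C(r, 2))%N, (p b), Q; split;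
  [exact: hp|exact: hQ|exact: Q0|exact: pb|].
exact: (first_integrals_of_wronskian field_derivD field_derivM Q0 S0).
Qed.

End HomogeneousField.

(** * Calculus in affine charts *)

Section Differentials.
Variables (K : numFieldType) (V : normedModType K).

Lemma is_diff_near0 (W : normedModType K) (f : V -> W) x :
  (\forall y \near x, f y = 0) -> is_diff x f (0 : V -> W).
Proof.
move=> f0; have E : f \o shift x = cst (f x) + 0 +o_ 0 id.
  apply/eqaddoP => e e0; rewrite (nbhs_singleton f0).
  move: f0; rewrite (near_shift 0 x); apply: filterS => y.
  rewrite /= subr0 => yx; rewrite !fctE /= yx.
  rewrite (_ : (0 : V -> W) y = 0) // addr0 subr0 normr0.
  by rewrite mulr_ge0 // ltW.
have c0 : continuous (0 : V -> W) by move=> z; exact: cst_continuous.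
have D : 'd f x = (0 : V -> W) :> (V -> W) by apply/diff_unique.
by split=> //; apply/diff_locallyP; rewrite D.
Qed.

Lemma is_diff_near_eq (W : normedModType K) (f g df : V -> W) x :
  (\forall y \near x, f y = g y) -> is_diff x f df -> is_diff x g df.
Proof.
move=> fg hf; have hz : is_diff x (g - f) (0 : V -> W).
  by apply: is_diff_near0; apply: filterS fg => y E; rewrite !fctE E subrr.
have -> : g = f + (g - f) by rewrite addrC subrK.
by have := is_diffD hf hz; rewrite addr0.
Qed.

Lemma is_diff_coord n (k : 'I_n) (z : 'rV[K]_n) :
  is_diff z (fun z : 'rV[K]_n => z 0 k) (fun v => v 0 k).
Proof.
have @f : {linear 'rV[K]_n -> K}.
  by exists (fun N : 'rV[K]_n => N 0 k); do 2![eexists]; do ?[constructor];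
     rewrite ?mxE// => ? *; rewrite ?mxE//; move=> ?; rewrite !mxE.
have fc : continuous f by exact: coord_continuous.
rewrite (_ : (fun _ => _) = f) //.
by apply: DiffDef; [exact: linear_differentiable|rewrite diff_lin].
Qed.

Lemma differentiable_row n (f : V -> 'rV[K]_n) x :
  (forall k, differentiable (fun y => f y 0 k) x) -> differentiable f x.
Proof.
move=> h; rewrite (_ : f = \sum_k (fun y => f y 0 k *: delta_mx 0 k)).
  by apply: differentiable_sum => k; exact: differentiableZl.
by apply/funext => y; rewrite fct_sumE {1}[f y]row_sum_delta.
Qed.

Lemma diff_row_coord n (f : V -> 'rV[K]_n) x v k : differentiable f x ->
  ('d f x v) 0 k = 'd (fun y => f y 0 k) x v.
Proof.
move=> h; have [hc E] := is_diff_coord k (f x).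
by have := diff_comp h hc; rewrite E => /(congr1 (@^~ v)) /= <-.
Qed.

Lemma is_diff_mul (f g df dg : V -> K) x : is_diff x f df -> is_diff x g dg ->
  is_diff x (fun y => f y * g y) (fun v => df v * g x + f x * dg v).
Proof.
move=> hf hg; have := is_diffM hf hg; congr (is_diff_def _ _ _).
by apply/funext => v; rewrite !fctE /GRing.scale /= addrC mulrC.
Qed.

Lemma is_diff_div (f g df dg : V -> K) x : is_diff x f df -> is_diff x g dg ->
  g x != 0 ->
  is_diff x (fun y => f y / g y) (fun v => (df v * g x - f x * dg v) / g x ^+ 2).
Proof.
move=> hf hg g0.
have hV : is_diff x (fun y => (g y)^-1) (fun v => - (g x) ^- 2 * dg v).
  apply: DiffDef; first by apply: differentiableV g0.
  by rewrite diffV //; apply/funext => v; case: hg => _ ->.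
have := is_diff_mul hf hV; congr (is_diff_def _ _ _).
by apply/funext => v; field.
Qed.

End Differentials.

Lemma euler_identity (K : numFieldType) n d (p : mpoly n K) :
  p \is ishomog1 d mdeg ->
  \sum_l mpolyX K (mnm1 l) * mderiv l p = d%:R *: p.
Proof.
move=> /dhomogP hp; rewrite {2}[p]mpolyE scaler_sumr.
rewrite (eq_bigr (fun l => \sum_(m <- msupp p)
    mcoeff m p *: ((m l)%:R *: mpolyX K m))); last first.
  move=> l _; rewrite {1}[p]mpolyE raddf_sum mulr_sumr; apply: eq_bigr => m _.
  rewrite /= mderivZ mderivX -!scalerAr -mpolyXD; congr (_ *: _).
  have [->|ml] := eqVneq (m l) 0%N; first by rewrite !scale0r.
  by rewrite addmC submK //; apply/mnm_lepP => i; rewrite mnm1E;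
    case: eqP => // <-; rewrite lt0n.
rewrite exchange_big /= big_seq [RHS]big_seq; apply: eq_bigr => m /hp /= md.
by rewrite -scaler_sumr -scaler_suml -natr_sum -mdegE md scalerA mulrC -scalerA.
Qed.

Lemma mpoly_ring_ind (K : comNzRingType) n (Q : mpoly n K -> Prop) :
  (forall c, Q (mpolyC n c)) -> (forall p q, Q p -> Q q -> Q (p + q)) ->
  (forall p q, Q p -> Q q -> Q (p * q)) -> (forall i, Q (mpolyX K (mnm1 i))) ->
  forall p, Q p.
Proof.
move=> QC QD QM QX; have Q1 : Q 1 by rewrite -(mpolyC1 n).
have QXn i k : Q (mpolyX K (mnm1 i) ^+ k).
  by elim: k => [//|k hk]; rewrite exprS; exact: QM.
move=> p; elim/mpolyind: p => [|c m p _ _ IH]; first by rewrite -(mpolyC0 n K).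
apply: (QD) => //; rewrite -mul_mpolyC mpolyXE_id; apply: (QM) => //.
by apply: (big_ind Q).
Qed.

Section Charts.
Variables (R : realType) (n : nat).
Local Notation C := (Cx R).
Local Notation P := (mpoly n.+1 C).
Implicit Types (z v : 'rV[C]_n) (j l : 'I_n.+1) (p : P).

(** The differential of [insert1 j]: a tangent vector of the chart seen in C^(n+1). *)
Definition lift_vec j v l : C := oapp (fun k => v 0 k) 0 (unlift j l).

Lemma is_diff_insert1 j z l :
  is_diff z (fun y : 'rV[C]_n => insert1 j y 0 l) (fun v => lift_vec j v l).
Proof.
rewrite /lift_vec; case: (unliftP j l) => [k ->|->] /=.
  rewrite (_ : (fun y => _) = fun y : 'rV[C]_n => y 0 k);
    first exact: is_diff_coord.
  by apply/funext => y; rewrite mxE liftK.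
rewrite (_ : (fun y => _) = cst 1); first exact: is_diff_cst.
by apply/funext => y; rewrite mxE unlift_none.
Qed.

(** Dehomogenization at x_j = 1; for a form of degree k this is p / x_j^k on the chart. *)
Definition chart_eval j p z : C := meval (fun i => insert1 j z 0 i) p.

Definition chart_diff j p z v : C :=
  \sum_l chart_eval j (mderiv l p) z * lift_vec j v l.

Lemma is_diff_chart_eval j p z : is_diff z (chart_eval j p) (chart_diff j p z).
Proof.
pose Q p := is_diff z (chart_eval j p) (chart_diff j p z).
have QC c : Q (mpolyC _ c).
  rewrite /Q (_ : chart_eval _ _ = cst c); last first.
    by apply/funext => y; rewrite /chart_eval mevalC.
  rewrite (_ : chart_diff _ _ _ = 0); first exact: is_diff_cst.
  apply/funext => v; rewrite /chart_diff big1 // => l _.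
  by rewrite mderivC /chart_eval meval0 mul0r.
have QD q q' : Q q -> Q q' -> Q (q + q').
  rewrite /Q => hp hq; have := is_diffD hp hq.
  rewrite (_ : chart_eval j q + chart_eval j q' = chart_eval j (q + q'));
    last first.
    by apply/funext => y; rewrite /chart_eval mevalD.
  rewrite (_ : chart_diff j q z + chart_diff j q' z = chart_diff j (q + q') z) //.
  apply/funext => v; rewrite /chart_diff !fctE -big_split; apply: eq_bigr => l _.
  by rewrite mderivD /chart_eval mevalD mulrDl.
have QM q q' : Q q -> Q q' -> Q (q * q').
  rewrite /Q => hp hq; have := is_diff_mul hp hq.
  rewrite (_ : (fun y => _) = chart_eval j (q * q')); last first.
    by apply/funext => y; rewrite /chart_eval mevalM.
  rewrite (_ : (fun v => _) = chart_diff j (q * q') z) //.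
  apply/funext => v; rewrite /chart_diff mulr_suml mulr_sumr -big_split.
  apply: eq_bigr => l _; rewrite mderivM /chart_eval mevalD !mevalM /=; ring.
have QX l : Q (mpolyX C (mnm1 l)).
  rewrite /Q (_ : chart_eval _ _ = fun y => insert1 j y 0 l); last first.
    by apply/funext => y; rewrite /chart_eval mevalXU.
  rewrite (_ : chart_diff _ _ _ = fun v => lift_vec j v l);
    first exact: is_diff_insert1.
  apply/funext => v; rewrite /chart_diff (bigD1 l) //= big1 ?addr0 => [|i il].
    rewrite mderivX mnm1E eqxx scale1r (_ : mnm_sub _ _ = mnm0).
      by rewrite mpolyX0 /chart_eval meval1 mul1r.
    by apply/mnmP => i; rewrite mnmBE subnn mnm0E.
  by rewrite mderivX mnm1E eq_sym (negbTE il) scale0r /chart_eval meval0 mul0r.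
exact: (@mpoly_ring_ind _ _ Q).
Qed.

Lemma form_at_pchart k p j z : is_form k p ->
  form_at p (pchart j z) / hcoord (pchart j z) 0 j ^+ k = chart_eval j p z.
Proof.
move=> hp; have [c c0 E] := hcoord_pchart j z.
rewrite /form_at (_ : meval _ p = c ^+ k * chart_eval j p z).
  rewrite E !mxE unlift_none /= mulr1 mulrAC divff ?mul1r // expf_neq0 //.
by rewrite -(meval_homog _ _ hp); apply: meval_eq => i; rewrite E mxE.
Qed.

(** The vector v is X minus X_j times the Euler field, the combination tangent to x_j = 1; Euler's
    identity evaluates the second term on p. *)
Lemma chart_diff_field (Xv : 'I_n.+1 -> P) d j p z v : is_form d p ->
  (forall l, lift_vec j v l = chart_eval j (Xv l) z - insert1 j z 0 l *
    chart_eval j (Xv j) z) ->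
  chart_diff j p z v = chart_eval j (field_deriv Xv p) z -
     d%:R * chart_eval j (Xv j) z * chart_eval j p z.
Proof.
move=> hp hv; have E := congr1 (fun q => chart_eval j q z) (euler_identity hp).
rewrite /chart_eval raddf_sum /= mevalZ in E.
rewrite /chart_diff (eq_bigr (fun l => chart_eval j (Xv l * mderiv l p) z -
   chart_eval j (Xv j) z * chart_eval j (mpolyX C (mnm1 l) * mderiv l p) z)).
  rewrite sumrB -mulr_sumr /chart_eval /field_deriv raddf_sum /= E.
  by congr (_ - _); ring.
move=> l _; rewrite hv /chart_eval !mevalM mevalXU; ring.
Qed.

End Charts.

(** * The homogeneous vector field of a foliation *)

(* In degree m the divergence inverts the contraction with the Euler field up to
   the factor n + m - 1. *)
Lemma koszul_exact (K : numClosedFieldType) n d (P : 'I_n.+1 -> 'I_n.+1 ->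
  mpoly n.+1 K) :
  let X i : mpoly n.+1 K := mpolyX K (mnm1 i) in
  (forall l j, P l j \is ishomog1 d.+2 mdeg) ->
  (forall l j i, X i * P l j = X j * P l i - X l * P j i) ->
  (forall j l, P j l = - P l j) ->
  exists2 Xv : 'I_n.+1 -> mpoly n.+1 K, forall l, Xv l \is ishomog1 d.+1 mdeg &
    forall l j, X j * Xv l - X l * Xv j = P l j.
Proof.
move=> X Phom rel PN.
pose N : K := (n + d.+1)%:R.
have N0 : N != 0 by rewrite pnatr_eq0 addnS.
exists (fun l => N^-1 *: \sum_j mderiv j (P l j)) => [l|l j].
  by apply: rpredZ; apply: rpred_sum => j _; exact/homog_mderiv/Phom.
have mderivXM i k p : mderiv i (X k * p) = (if i == k then p else 0) + X k *
  mderiv i p.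
  rewrite mderivM; congr (_ + _); rewrite /X mderivX mnm1E eq_sym.
  have [->|_] := eqVneq i k; last by rewrite scale0r mul0r.
  rewrite scale1r (_ : mnm_sub _ _ = mnm0) ?mpolyX0 ?mul1r //.
  by apply/mnmP => m; rewrite mnmBE subnn mnm0E.
have div k (q : 'I_n.+1 -> mpoly n.+1 K) :
    \sum_i mderiv i (X k * q i) = q k + X k * \sum_i mderiv i (q i).
  under eq_bigr do rewrite mderivXM.
  by rewrite big_split -big_mkcond big_pred1_eq -mulr_sumr.
(* Divergence of both sides of [rel]. Euler's identity gives (n + 1) + (d + 2) copies of P l j on
   the left; on the right each product gives one more copy, by antisymmetry, whence the two
   subtractions of 1 in N below. *)
have S1 : \sum_i mderiv i (X i * P l j) = (n.+1%:R + d.+2%:R) *: P l j.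
  under eq_bigr do rewrite mderivXM eqxx.
  rewrite big_split /= (euler_identity (Phom l j)) sumr_const card_ord.
  by rewrite [RHS]scalerDl -scaler_nat.
have S2 : \sum_i mderiv i (X i * P l j) =
    \sum_i mderiv i (X j * P l i) - \sum_i mderiv i (X l * P j i).
  by rewrite -sumrB; apply: eq_bigr => i _; rewrite (rel l j i) mderivB.
rewrite -!scalerAr -scalerBr; apply: (scalerI N0); rewrite scalerA divff // scale1r.
rewrite S1 !div (PN j l) in S2.
have -> : N = n.+1%:R + d.+2%:R - 1 - 1.
  by rewrite /N natrD -[n.+1%:R]natr1 -[d.+2%:R]natr1; ring.
rewrite !scalerBl S2 !scale1r.
move: (X j * _) (X l * _) (P l j) => a b p.
by ring.
Qed.

Section GlobalField.
Variables (R : realType) (n : nat).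
Local Notation C := (Cx R).
Implicit Types (i j l : 'I_n.+1) (x : 'rV[C]_n.+1).

Definition dehom j x : 'rV[C]_n := \row_k (x 0 (lift j k) / x 0 j).

Lemma dehomZ j c x : c != 0 -> dehom j (c *: x) = dehom j x.
Proof. by move=> c0; apply/rowP => k; rewrite !mxE -mulf_div divff ?mul1r. Qed.

Lemma insert1_dehom j x : x 0 j != 0 -> insert1 j (dehom j x) = (x 0 j)^-1 *: x.
Proof.
move=> xj; apply/rowP => l; rewrite !mxE.
by case: (unliftP j l) => [k ->|->]; rewrite /= ?mxE ?mulVf // mulrC.
Qed.

Lemma dehom_insert1 j (z : 'rV[C]_n) : dehom j (insert1 j z) = z.
Proof. by apply/rowP => k; rewrite !mxE liftK unlift_none /= divr1. Qed.

Lemma insert1_self j (z : 'rV[C]_n) : insert1 j z 0 j = 1.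
Proof. by rewrite mxE unlift_none. Qed.

Lemma aff_coord_pchart i j (z : 'rV[C]_n) :
  aff_coord j (pchart i z) = dehom j (insert1 i z).
Proof. by have [c c0 E] := hcoord_pchart i z; rewrite -(dehomZ _ _ c0) -E. Qed.

Lemma affine_pchartE i j (z : 'rV[C]_n) :
  affine j (pchart i z) = (insert1 i z 0 j != 0) :> Prop.
Proof.
have [c c0 E] := hcoord_pchart i z.
by rewrite /affine /= E mxE mulf_eq0 negb_or c0.
Qed.

Lemma hcoord_neq0 (p : proj_space R n) : hcoord p != 0.
Proof.
rewrite /hcoord vpick0; case: p => L /= hL.
by apply: contraTneq hL => ->; rewrite dimv0.
Qed.

Lemma hcoord_line (p : proj_space R n) : sval p = <[hcoord p]>%VS.
Proof.
case: p => L hL; rewrite /hcoord /=; apply/esym/eqP.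
rewrite eqEdim (eqP hL) dim_vline vpick0 -memvE memv_pick.
by rewrite -dimv_eq0 (eqP hL).
Qed.

Lemma proj_space_eq (p q : proj_space R n) : sval p = sval q -> p = q.
Proof.
by case: p q => [L hL] [L' hL'] /= E; case: _ / E hL' => hL'; congr exist;
  exact: bool_irrelevance.
Qed.

Lemma aff_coordK j (p : proj_space R n) : affine j p ->
  pchart j (aff_coord j p) = p.
Proof.
move=> pj; apply: proj_space_eq; rewrite [RHS]hcoord_line /=.
rewrite [aff_coord j p](_ : _ = dehom j (hcoord p)) // insert1_dehom //.
apply/eqP; rewrite eqEsubv -!memvE memvZ ?memv_line //=.
by rewrite -[X in X \in _](scalerKV pj) memvZ ?memv_line.
Qed.

Lemma differentiable_dehom j x : x 0 j != 0 -> differentiable (dehom j) x.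
Proof.
move=> xj; apply: differentiable_row => k.
rewrite (_ : (fun y => _) = fun y : 'rV[C]_n.+1 => y 0 (lift j k) / y 0 j);
  last first.
  by apply/funext => y; rewrite mxE.
by have [] := is_diff_div (is_diff_coord (lift j k) x) (is_diff_coord j x) xj.
Qed.

Lemma diff_transition i j (z v : 'rV[C]_n) k : insert1 i z 0 j != 0 ->
  ('d (aff_coord j \o pchart i) z v) 0 k =
  (lift_vec i v (lift j k) * insert1 i z 0 j - insert1 i z 0 (lift j k) *
    lift_vec i v j)
    / insert1 i z 0 j ^+ 2.
Proof.
move=> zj.
have -> : aff_coord j \o pchart i = fun y : 'rV[C]_n => dehom j (insert1 i y).
  by apply/funext => y; rewrite /= aff_coord_pchart.
pose G k := fun y : 'rV[C]_n => insert1 i y 0 (lift j k) / insert1 i y 0 j.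
have hG k' := is_diff_div (is_diff_insert1 i z (lift j k')) (is_diff_insert1 i z
  j) zj.
have GE k' : (fun y : 'rV[C]_n => dehom j (insert1 i y) 0 k') = G k'.
  by apply/funext => y; rewrite mxE.
rewrite diff_row_coord ?GE; first by have [_ ->] := hG k.
by apply: differentiable_row => k'; rewrite GE; case: (hG k').
Qed.

Variables (F : foliation R n) (d : nat).
Hypothesis hF : fol_degree F d.+1.

(** Here [d] is the degree of the foliation minus one. The last clause, compatibility with the
    cocycle (x_j / x_i)^d of O(d), is what will make the rescaled fields homogeneous. *)
Lemma degree_scaling : exists lam : fol_index F -> 'I_n.+1 -> proj_space R n -> C,
  [/\ forall a j, holomorphic (fol_cover a `&` affine j) (lam a j),
      forall a j p, fol_cover a p -> affine j p -> lam a j p != 0,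
      forall a b j p, fol_cover a p -> fol_cover b p -> affine j p ->
        lam b j p = lam a j p * fol_trans a b p &
      forall a i j p, fol_cover a p -> affine i p -> affine j p ->
        lam a j p * hcoord p 0 j ^+ d = lam a i p * hcoord p 0 i ^+ d].
Proof.
move: hF; rewrite /fol_degree (_ : d.+1%:Z - 1 = d%:Z);
  last by rewrite -addn1 PoszD addrK.
move=> [lam [hlam rel]].
have lam0 a j p : fol_cover a p -> affine j p -> lam a j p != 0.
  by move=> ap jp; have [_] := hlam a j; apply.
have lamg a b j p : fol_cover a p -> fol_cover b p -> affine j p ->
    lam b j p = lam a j p * fol_trans a b p.
  move=> ap bp jp; have := rel a b j j p ap bp jp jp.
  by rewrite /= divff // exp1rz mul1r.
exists lam; split => //; first by move=> a j; case: (hlam a j).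
move=> a i j p ap ip jp; have := rel a a i j p ap ap ip jp; rewrite /=.
(* Obtained from the isomorphism: lam a = lam a * g_aa with lam a nonzero. *)
have -> : fol_trans a a p = 1.
  by apply: (mulfI (lam0 a i p ap ip)); rewrite -lamg // mulr1.
rewrite mulr1 -exprnP => <-; rewrite exprMn exprVn.
by rewrite [RHS]mulrAC divfK ?expf_neq0 // mulrC.
Qed.

Lemma lift_vecZ i (c : C) (v : 'rV[C]_n) l : lift_vec i (c *: v) l = c * lift_vec
  i v l.
Proof. by rewrite /lift_vec; case: unlift => [k|] /=; rewrite ?mxE ?mulr0. Qed.

Lemma lift_vec_self i (v : 'rV[C]_n) : lift_vec i v i = 0.
Proof. by rewrite /lift_vec unlift_none. Qed.

Lemma lift_vec_lift i (v : 'rV[C]_n) k : lift_vec i v (lift i k) = v 0 k.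
Proof. by rewrite /lift_vec liftK. Qed.

(* The local fields, rescaled by the isomorphism of line bundles, glue to one
   field [V j] on each affine chart. *)
Lemma rescaled_field : exists V : 'I_n.+1 -> 'rV[C]_n -> 'rV[C]_n,
  [/\ forall a j z, fol_cover a (pchart j z) ->
        exists2 c : C, c != 0 & V j z = c *: fol_field (f := F) a j z,
      forall j z k, differentiable (fun y => V j y 0 k) z &
      forall i j l x, x 0 i != 0 -> x 0 j != 0 ->
        x 0 i * (x 0 j ^+ d.+2 * lift_vec j (V j (dehom j x)) l) =
        x 0 j * (x 0 i ^+ d.+2 * lift_vec i (V i (dehom i x)) l) -
        x 0 l * (x 0 i ^+ d.+2 * lift_vec i (V i (dehom i x)) j)].
Proof.
have [lam [hlam lam0 lamg lamx]] := degree_scaling.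
have /choice[idx hidx] := @fol_covers R n F.
(* [idx] picks some member of the cover at each point; by [VE] the result does not depend on it. *)
pose V j z := lam (idx (pchart j z)) j (pchart j z) *: fol_field (f :=
  F) (idx (pchart j z)) j z.
have VE a j z : fol_cover a (pchart j z) ->
  V j z = lam a j (pchart j z) *: fol_field (f := F) a j z.
  move=> az; have bz := hidx (pchart j z); have jz := affine_pchart j z.
  by rewrite /V (lamg a _ j _ az bz jz) (fol_glue (conj az bz)) scalerA.
exists V; split.
- move=> a j z az; exists (lam a j (pchart j z)); last exact: VE.
  exact: lam0 az (affine_pchart j z).
- move=> j z k; pose a := idx (pchart j z);
  have az : fol_cover a (pchart j z) by exact: hidx.
  have jz := affine_pchart j z.
  have dl : differentiable (lam a j \o pchart j) z by apply: hlam; split.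
  have df : differentiable (fol_field (f := F) a j) z by apply: (fol_hol (f :=
    F) a).1.
  have [hc E] := is_diff_coord k (fol_field (f := F) a j z).
  have dfk := differentiable_comp df hc.
  have [] := @is_diff_near_eq _ _ _ ((lam a j \o pchart j) * ((fun v : 'rV[C]_n
    => v 0 k) \o fol_field (f := F) a j))
     (fun y => V j y 0 k) _ z _ (differentiableP (differentiableM dl dfk)).
    have : nbhs z (pchart j @^-1` fol_cover a).
      by apply: open_nbhs_nbhs; split; [exact: fol_open|].
    by apply: filterS => y ay; rewrite (VE a) // mxE.
  by [].
move=> i j l x xi xj; pose z := dehom i x; pose p := pchart i z.
have zE : insert1 i z = (x 0 i)^-1 *: x by exact: insert1_dehom.
have zj : insert1 i z 0 j != 0 by rewrite zE mxE mulf_neq0 ?invr_eq0.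
have jp : affine j p by rewrite affine_pchartE.
have ip : affine i p by exact: affine_pchart.
pose a := idx p; have ap : fol_cover a p by exact: hidx.
have jx : aff_coord j p = dehom j x.
  by rewrite aff_coord_pchart zE dehomZ // invr_eq0.
have VjE : V j (dehom j x) = lam a j p *: 'd (aff_coord j \o pchart i) z
  (fol_field (f := F) a i z).
  rewrite -jx (VE a) aff_coordK //; congr (_ *: _).
  by apply: (fol_hol (f := F) a).2; split.
have lamE : lam a j p * x 0 j ^+ d = lam a i p * x 0 i ^+ d.
  have := lamx a i j p ap ip jp.
  have [c c0 E] := hcoord_pchart i z; rewrite E zE !mxE !exprMn.
  have : c ^+ d * ((x 0 i)^-1) ^+ d != 0 by rewrite mulf_neq0 ?expf_neq0 ?invr_eq0.
  set e := c ^+ d; set e' := _^-1 ^+ d => ee.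
  rewrite [e * (e' * x 0 j ^+ d)]mulrA [e * (e' * _)]mulrA !(mulrCA _ (e * e')).
  exact: mulfI.
case: (unliftP j l) => [k ->|->]; last by rewrite lift_vec_self !mulr0 subrr.
rewrite lift_vec_lift VjE mxE diff_transition // -/z (VE a i z ap) !lift_vecZ zE
  !mxE.
move: (lift_vec i _ _) (lift_vec i _ _) => v w.
have -> : lam a i (pchart i z) = lam a j p * x 0 j ^+ d / x 0 i ^+ d.
  by rewrite lamE mulfK ?expf_neq0.
(* The exponent d + 2 collects x^d from the change of [lam] and x^2 from the denominator in the
   derivative of the coordinate change. *)
rewrite -[d.+2]addn2 !exprD.
by field; rewrite ?xi ?xj ?expf_neq0.
Qed.

Lemma coords_eq0 x : (forall i, x 0 i = 0) -> x = 0.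
Proof. by move=> h; apply/rowP => i; rewrite h mxE. Qed.

(* The contraction of the field with the Euler field, a bivector whose
   coefficients are homogeneous and defined on all of C^(n+1). *)
Lemma wedge_euler_polynomial (V : 'I_n.+1 -> 'rV[C]_n -> 'rV[C]_n) :
  (forall j z k, differentiable (fun y => V j y 0 k) z) ->
  (forall i j l x, x 0 i != 0 -> x 0 j != 0 ->
     x 0 i * (x 0 j ^+ d.+2 * lift_vec j (V j (dehom j x)) l) =
     x 0 j * (x 0 i ^+ d.+2 * lift_vec i (V i (dehom i x)) l) -
     x 0 l * (x 0 i ^+ d.+2 * lift_vec i (V i (dehom i x)) j)) ->
  exists P : 'I_n.+1 -> 'I_n.+1 -> mpoly n.+1 C,
    (forall l j, P l j \is ishomog1 d.+2 mdeg) /\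
    forall l j i x, x 0 i != 0 -> x 0 i * meval (fun k => x 0 k) (P l j) =
      x 0 j * (x 0 i ^+ d.+2 * lift_vec i (V i (dehom i x)) l) -
      x 0 l * (x 0 i ^+ d.+2 * lift_vec i (V i (dehom i x)) j).
Proof.
move=> Vdiff Vchange.
pose L i l x := x 0 i ^+ d.+2 * lift_vec i (V i (dehom i x)) l.
(* The coefficient (l, j) of the bivector, computed from any nonzero coordinate; [LamE] shows
   independence of the choice. The value at the origin is forced by homogeneity. *)
pose Lam l j x := if [pick i | x 0 i != 0] is Some i then
  (x 0 i)^-1 * (x 0 j * L i l x - x 0 l * L i j x) else 0.
have LamE l j i x : x 0 i != 0 ->
  Lam l j x = (x 0 i)^-1 * (x 0 j * L i l x - x 0 l * L i j x).
  move=> xi; rewrite /Lam; case: pickP => [i' xi'|/(_ i)]; last by rewrite xi.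
  have E k : L i' k x = (x 0 i)^-1 * (x 0 i' * L i k x - x 0 k * L i i' x).
    by apply: (mulfI xi); rewrite mulVKf // -Vchange.
  by rewrite !E; field; rewrite xi xi'.
have Lam0 l j : Lam l j 0 = 0.
  by rewrite /Lam; case: pickP => // i; rewrite mxE eqxx.
have LamZ l j (c : C) x : Lam l j (c *: x) = c ^+ d.+2 * Lam l j x.
  have [->|c0] := eqVneq c 0; first by rewrite scale0r Lam0 expr0n mul0r.
  have [->|x0] := eqVneq x 0; first by rewrite scaler0 Lam0 mulr0.
  have [i xi] : exists i, x 0 i != 0.
    apply: contrapT => h; case/eqP: x0; apply: coords_eq0 => i.
    by apply/eqP; apply: contrapT => /negP hi; apply: h; exists i.
  have cxi : (c *: x) 0 i != 0 by rewrite mxE mulf_neq0.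
  rewrite (LamE l j i x xi) (LamE l j i _ cxi) /L dehomZ // !mxE exprMn.
  move: (lift_vec i _ l) (lift_vec i _ j) => v w.
  move: (x 0 i ^+ d.+2) (c ^+ d.+2) => e e'.
  by field; rewrite c0 xi.
have Ldiff i l x : x 0 i != 0 -> differentiable (L i l) x.
  move=> xi; have [dc _] := is_diff_coord i x.
  have d1 : differentiable ((fun y : 'rV[C]_n.+1 =>
    y 0 i) ^+ d.+2) x by exact: differentiableX.
  have d2 : differentiable (fun y => lift_vec i (V i (dehom i y)) l) x.
    case: (unliftP i l) => [k ->|->].
      rewrite (_ : (fun y => _) = (fun v => V i v 0 k) \o dehom i).
        by apply: differentiable_comp; [exact: differentiable_dehom|exact: Vdiff].
      by apply/funext => y; rewrite /= lift_vec_lift.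
    rewrite (_ : (fun y => _) = cst 0); first exact: differentiable_cst.
    by apply/funext => y; rewrite lift_vec_self.
  have E : L i l = (fun y : 'rV[C]_n.+1 => y 0 i) ^+ d.+2 *
      (fun y => lift_vec i (V i (dehom i y)) l).
    by apply/funext => y; rewrite /L !fctE.
  by rewrite E; exact: differentiableM.
have Lamdiff l j x : x != 0 -> differentiable (Lam l j) x.
  move=> x0; have [i xi] : exists i, x 0 i != 0.
    apply: contrapT => h; case/eqP: x0; apply: coords_eq0 => i.
    by apply/eqP; apply: contrapT => /negP hi; apply: h; exists i.
  have coord k : is_diff x (fun y : 'rV[C]_n.+1 => y 0 k) (fun v =>
    v 0 k) by exact: is_diff_coord.
  have h1 k k' := is_diff_mul (coord k) (differentiableP (Ldiff i k' x xi)).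
  have [h2 _] := is_diff_div (is_diffB (h1 j l) (h1 l j)) (coord i) xi.
  have E : nbhs x [set y : 'rV[C]_n.+1 | y 0 i != 0].
    have [ci _] := coord i; exact: differentiable_continuous ci _ (near_neq xi).
  have {}E : nbhs x [set y : 'rV[C]_n.+1 |
      (y 0 j * L i l y - y 0 l * L i j y) / y 0 i = Lam l j y].
    by apply: filterS E => y /= yi; rewrite /= (LamE l j i y yi) mulrC.
  by have [] := @is_diff_near_eq _ _ _ _ (Lam l j) _ x E (differentiableP h2).
have /choice[P hP] : forall q : 'I_n.+1 * 'I_n.+1, exists P : mpoly n.+1 C,
    P \is ishomog1 d.+2 mdeg /\ forall x, Lam q.1 q.2 x = meval (fun i => x 0 i) P.
  move=> [l j]; have [P h1 h2] :=
    homogeneous_function_mpoly (LamZ l j) (Lamdiff l j).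
  by exists P.
exists (fun l j => P (l, j)); split=> [l j|l j i x xi]; first by case: (hP (l, j)).
by rewrite -(hP (l, j)).2 (LamE l j i x xi) mulVKf.
Qed.

(** The bivector satisfies the cocycle relation of the Koszul complex, hence is the wedge of some X
    with the Euler field; restricting to x_j = 1 recovers the local fields up to nonzero factors. *)
Lemma homogeneous_vector_field : exists Xv : 'I_n.+1 -> mpoly n.+1 C,
  (forall l, Xv l \is ishomog1 d.+1 mdeg) /\
  forall a j z, fol_cover a (pchart j z) -> exists2 c : C, c != 0 &
    forall l, c * lift_vec j (fol_field (f := F) a j z) l =
      chart_eval j (Xv l) z - insert1 j z 0 l * chart_eval j (Xv j) z.
Proof.
have [V [VE Vdiff Vchange]] := rescaled_field.
have [P [Phom hP]] := wedge_euler_polynomial Vdiff Vchange.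
pose X i : mpoly n.+1 C := mpolyX C (mnm1 i).
have X0 i : X i != 0 by rewrite -(msize_poly_eq0 (X i)) msizeX.
(* Multiplying the difference by [X i] makes it vanish on x_i = 0 as well, hence everywhere. *)
have poly_eq i (p q : mpoly n.+1 C) : (forall x : 'rV[C]_n.+1, x 0 i != 0 ->
    meval (fun k => x 0 k) p = meval (fun k => x 0 k) q) -> p = q.
  move=> h; apply/eqP; rewrite -subr_eq0 -(mulrI_eq0 _ (lregP (X0 i))); apply/eqP.
  apply: mpoly_ext => x; rewrite mevalM mevalXU mevalB.
  have [->|xi] := eqVneq (x i) 0; first by rewrite mul0r.
  have E p' : meval x p' = meval (fun k => (\row_k x k : 'rV[C]_n.+1) 0 k) p'.
    by apply: meval_eq => k; rewrite mxE.
  by rewrite !E h ?subrr ?mulr0 // mxE.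
have rel l j i : X i * P l j = X j * P l i - X l * P j i.
  apply: (poly_eq i) => x xi; rewrite mevalB !mevalM !mevalXU hP //.
  by congr (_ - _); apply: (mulfI xi);
    rewrite [RHS]mulrCA hP // lift_vec_self !mulr0 subr0 mulrCA.
have Pll l : P l l = 0.
  apply: (poly_eq l) => x xl; rewrite meval0; apply: (mulfI xl).
  by rewrite hP // subrr mulr0.
have PN l j : P j l = - P l j.
  by apply: (mulfI (X0 l)); rewrite mulrN (rel l j l) Pll mulr0 sub0r opprK.
have [Xv Xvhom XvP] := koszul_exact Phom rel (fun j l => PN l j).
exists Xv; split => //.
move=> a j z az; have [c c0 E] := VE a j z az; exists c => // l.
have yj : insert1 j z 0 j != 0 by rewrite insert1_self oner_neq0.
have := hP l j j (insert1 j z) yj.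
rewrite lift_vec_self !mulr0 subr0 dehom_insert1 insert1_self expr1n !mul1r E
  lift_vecZ => <-.
rewrite -XvP mevalB !mevalM !mevalXU insert1_self mul1r.
by congr (_ - _ * _).
Qed.

End GlobalField.

(** * Invariant hypersurfaces and the rational first integral *)

Section ProjectivePoints.
Variables (R : realType) (n : nat).
Local Notation C := (Cx R).
Implicit Types (x : 'rV[C]_n.+1) (p : proj_space R n).

Lemma line_point x : x != 0 -> exists p : proj_space R n, sval p = <[x]>%VS.
Proof.
move=> x0; have h : \dim <[x]>%VS == 1%N by rewrite dim_vline x0.
by exists (exist _ <[x]>%VS h).
Qed.

Lemma form_at_line p x : sval p = <[x]>%VS ->
  exists2 c : C, c != 0 & forall k (f : mpoly n.+1 C), is_form k f ->
    form_at f p = c ^+ k * meval (fun i => x 0 i) f.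
Proof.
move=> px; have := memv_line (hcoord p); rewrite -hcoord_line px.
move=> /vlineP[c cE]; exists c.
  by apply: contra_neq (hcoord_neq0 p) => c0; rewrite cE c0 scale0r.
move=> k f hf; rewrite -(meval_homog _ _ hf).
by apply: meval_eq => i; rewrite cE mxE.
Qed.

Lemma mpoly_nonzero_point (f : mpoly n.+1 C) : f != 0 ->
  exists2 x : 'rV[C]_n.+1, x != 0 & meval (fun i => x 0 i) f != 0.
Proof.
(* The coordinate factor keeps the point found away from the origin. *)
move=> f0; pose g := mpolyX C (mnm1 0) * f.
have g0 : g != 0 by rewrite mulf_neq0 // -(msize_poly_eq0 (mpolyX C _)) msizeX.
have [x gx] : exists x : 'I_n.+1 -> C, meval x g != 0.
  apply: contrapT => h; case/eqP: g0; apply: mpoly_ext => x.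
  by apply/eqP; apply: contrapT => /negP hx; apply: h; exists x.
move: gx; rewrite mevalM mevalXU mulf_eq0 negb_or => /andP[x0 fx].
exists (\row_i x i); first by apply: contra_neq x0 => /rowP/(_ 0); rewrite !mxE.
by rewrite (@meval_eq _ _ _ x) // => i; rewrite mxE.
Qed.

(** Irreducible because a product of two nonzero forms is nonzero at some point. The target of the
    first integral will be P^1. *)
Lemma proj_space_variety : projective_variety (@setT (proj_space R n)).
Proof.
split.
- exists set0; split; first by move=> f [].
  by apply/seteqP; split=> [p _ f []|p _].
- by exists (pchart 0 0).
move=> A B [SA [fA ->]] [SB [fB ->]] AB.
apply: contrapT => /not_orP[/existsNP[p /not_implyP[_ nAp]] /existsNP[q
  /not_implyP[_ nBq]]].
have [f [Sf fp]] : exists f, SA f /\ ~ zeros f p.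
  by apply: contrapT => h; apply: nAp => f Sf; apply: contrapT => hp; apply: h;
    exists f.
have [g [Sg gq]] : exists g, SB g /\ ~ zeros g q.
  by apply: contrapT => h; apply: nBq => g Sg; apply: contrapT => hp; apply: h;
    exists g.
have f0 : f != 0 by apply/eqP => E; apply: fp; rewrite E /zeros /form_at /= meval0.
have g0 : g != 0 by apply/eqP => E; apply: gq; rewrite E /zeros /form_at /= meval0.
have [x x0] := mpoly_nonzero_point (mulf_neq0 f0 g0).
rewrite mevalM mulf_eq0 negb_or => /andP[fx gx].
have [r rx] := line_point x0.
have [[e fe] [e' ge]] := (fA f Sf, fB g Sg).
have [c c0 cE] := form_at_line rx.
case: (AB r I) => [/(_ f Sf)|/(_ g Sg)];
  rewrite /zeros /= (cE _ _ fe, cE _ _ ge) => /eqP.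
  by rewrite mulf_eq0 expf_eq0 (negbTE c0) andbF (negbTE fx).
by rewrite mulf_eq0 expf_eq0 (negbTE c0) andbF (negbTE gx).
Qed.

Lemma chart_diffZ j (f : mpoly n.+1 C) (z v : 'rV[C]_n) (c : C) :
  chart_diff j f z (c *: v) = c * chart_diff j f z v.
Proof.
by rewrite /chart_diff mulr_sumr; apply: eq_bigr => l _; rewrite lift_vecZ mulrCA.
Qed.

End ProjectivePoints.

(** The quotient rule for x / y in a chart. The Euler corrections m x and m y carry the same m since
    both forms have the same degree, so they cancel. *)
Lemma proportional_quotient (K : fieldType) (b u w x y dx dy m : K) : b != 0 ->
  b * u = dx - m * x -> b * w = dy - m * y -> dx * y = x * dy ->
  (u * y - x * w) / y ^+ 2 = 0.
Proof.
move=> b0 ub wb E; rewrite (_ : u * y - x * w = 0) ?mul0r //; apply: (mulfI b0).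
rewrite mulr0 (_ : b * (u * y - x * w) = b * u * y - x * (b * w)); last by ring.
rewrite ub wb (_ : (dx - m * x) * y - x * (dy - m * y) = dx * y - x * dy);
  last by ring.
by rewrite E subrr.
Qed.

Section Assembly.
Variables (R : realType) (n d : nat) (F : foliation R n).
Local Notation C := (Cx R).
Variable Xv : 'I_n.+1 -> mpoly n.+1 C.
Hypothesis Xv_homog : forall l, Xv l \is ishomog1 d.+1 mdeg.
Hypothesis XvP : forall a j z, fol_cover a (pchart j z) -> exists2 c : C, c != 0 &
  forall l, c * lift_vec j (fol_field (f := F) a j z) l =
    chart_eval j (Xv l) z - insert1 j z 0 l * chart_eval j (Xv j) z.

Lemma chart_diff_foliation a j z : fol_cover a (pchart j z) ->
  exists2 c : C, c != 0 & forall k (f : mpoly n.+1 C), is_form k f ->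
    c * chart_diff j f z (fol_field (f := F) a j z) =
    chart_eval j (field_deriv Xv f) z - k%:R * chart_eval j (Xv j) z * chart_eval
      j f z.
Proof.
move=> az; have [c c0 cE] := XvP az; exists c => // k f hf.
by rewrite -chart_diffZ; apply: chart_diff_field => // l; rewrite lift_vecZ.
Qed.

(** At a zero of f both the cofactor term and the Euler correction vanish, so X f vanishes there
    too; the Nullstellensatz then excludes that f does not divide X f. *)
Lemma invariant_form_divides k (f : mpoly n.+1 C) : is_form k f ->
  irreducible_elt f ->
  (0 < k)%N ->
  (forall j, invariant_locus F (affine j)
     (fun (_ : 'I_1) p => form_at f p / hcoord p 0 j ^+ k)) ->
  divides f (field_deriv Xv f).
Proof.
move=> fk fi k0 finv; apply: contrapT =>
  /(irreducible_nullstellensatz fi)[x fx Xfx].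
have Xfk := homog_field_deriv Xv_homog fk.
(* X f has positive degree k + d, so it vanishes at the origin, and x is a projective point. *)
have [j xj] : exists j, x j != 0.
  apply: contrapT => h; have x0 i : x i = 0.
    by apply/eqP; apply: contrapT => /negP hi; apply: h; exists i.
  move: Xfx; rewrite (@meval_eq _ _ x (fun i => 0 * x i)); last by move=> i;
    rewrite mul0r x0.
  by rewrite (meval_homog _ _ Xfk) expr0n addn_eq0 (gtn_eqF k0) mul0r eqxx.
pose y : 'rV[C]_n.+1 := \row_i x i; pose z := dehom j y.
have zE i : insert1 j z 0 i = (x j)^-1 * x i.
  by rewrite insert1_dehom ?mxE // !mxE.
have evalE m g : g \is ishomog1 m mdeg ->
  chart_eval j g z = (x j)^-1 ^+ m * meval x g.
  by move=> hg; rewrite -(meval_homog _ _ hg); apply: meval_eq => i; rewrite zE.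
have [a az] := @fol_covers R n F (pchart j z).
have [c c0 cE] := chart_diff_foliation az.
have [h [_ hE]] := finv j a ord0.
have fz : chart_eval j f z = 0 by rewrite (evalE _ _ fk) fx mulr0.
have := hE j z (conj az (affine_pchart j z)).
rewrite big_ord1 (form_at_pchart j z fk) fz mulr0 /vderiv.
have -> : (fun p => form_at f p / hcoord p 0 j ^+ k) \o pchart j = chart_eval j f.
  by apply/funext => w; rewrite /= form_at_pchart.
have [_ ->] := is_diff_chart_eval j f z => dE.
have := cE k f fk; rewrite dE mulr0 fz mulr0 subr0 (evalE _ _ Xfk) => /esym/eqP.
by rewrite mulf_eq0 expf_eq0 invr_eq0 (negbTE xj) andbF (negbTE Xfx).
Qed.

Lemma rational_first_integral_of_forms e (p q : mpoly n.+1 C) :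
  is_form e p -> is_form e q -> q != 0 -> (forall c, p != c *: q) ->
  field_deriv Xv q * p = field_deriv Xv p * q ->
  has_rational_first_integral F.
Proof.
move=> hp hq q0 npq XE.
pose T (i : 'I_2) := if i == 0 then p else q.
have hT i : is_form e (T i) by rewrite /T; case: ifP.
have TE i l : field_deriv Xv (T i) * T l = T i * field_deriv Xv (T l).
  rewrite /T; case: (i == 0); case: (l == 0).
  - exact: mulrC.
  - by rewrite -XE; exact: mulrC.
  - by rewrite XE; exact: mulrC.
  - exact: mulrC.
exists 1, setT, e, T; split=> //; first exact: proj_space_variety.
(* Two points with different images: c is the value of p / q at the first, and the second avoids the
   zeros of q and of p - c q. *)
- have [x x0 qx] := mpoly_nonzero_point q0.
  pose c := meval (fun i => x 0 i) p / meval (fun i => x 0 i) q.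
  have pc0 : p - c *: q != 0 by rewrite subr_eq0.
  have [x' x'0] := mpoly_nonzero_point (mulf_neq0 q0 pc0).
  rewrite mevalM mulf_eq0 negb_or => /andP[qx' pcx'].
  have [r rx] := line_point x0; have [r' rx'] := line_point x'0.
  have row_neq0 (s : proj_space R n) (w : 'rV[C]_n.+1) : sval s = <[w]>%VS ->
    meval (fun i => w 0 i) q != 0 -> rmap_row T s != 0.
    move=> sw qw; apply/eqP => /rowP/(_ 1); rewrite !mxE /T /=.
    have [b b0 bE] := form_at_line sw.
    by rewrite (bE _ _ hq); apply/eqP; rewrite mulf_neq0 ?expf_neq0.
  have [y yE] := line_point (row_neq0 _ _ rx qx).
  have [y' y'E] := line_point (row_neq0 _ _ rx' qx').
  exists r, r', y, y'; split=> // yy'.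
  have : rmap_row T r' \in <[rmap_row T r]>%VS by rewrite -yE yy' y'E memv_line.
  move=> /vlineP[b /rowP bE]; have := bE 0; have := bE 1; rewrite !mxE /T /=.
  have [s s0 sE] := form_at_line rx; have [s' s'0 s'E] := form_at_line rx'.
  rewrite !(s'E _ _ hp, s'E _ _ hq, sE _ _ hp, sE _ _ hq) => q_b p_b.
  case/eqP: pcx'; rewrite mevalB mevalZ.
  apply: (mulfI (expf_neq0 e s'0)); rewrite mulr0 mulrBr mulrCA q_b p_b /c.
  by field.
(* The cofactors are 0 because the field annihilates the quotients T_i / T_l. *)
- move=> y _ l yl a i; exists (fun _ _ => 0); split.
    by move=> _ j z _; exact: differentiable_cst.
  move=> j z [az lz]; rewrite big1 => [|? _]; last by rewrite mul0r.
  have hj (w : 'rV[C]_n) : hcoord (pchart j w) 0 j ^+ e != 0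
    by rewrite expf_neq0 //; exact: affine_pchart.
  have form_chart i' w : rmap_row T (pchart j w) 0 i' =
      chart_eval j (T i') w * hcoord (pchart j w) 0 j ^+ e.
    by rewrite mxE -(form_at_pchart j w (hT i')) divfK.
  have lz' : chart_eval j (T l) z != 0.
    by move: lz; rewrite /= form_chart mulf_eq0 negb_or => /andP[].
  rewrite /vderiv; set c0 := hcoord y 0 i / hcoord y 0 l.
  have -> : (fun p0 => rmap_row T p0 0 i / rmap_row T p0 0 l - c0) \o pchart j =
      (fun w => chart_eval j (T i) w / chart_eval j (T l) w) - cst c0.
    apply/funext => w; rewrite /= !form_chart !fctE /=; congr (_ - _).
    by rewrite -mulf_div divff ?mulr1.
  have [_ ->] := is_diffB (is_diff_div (is_diff_chart_eval j (T i) z)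
    (is_diff_chart_eval j (T l) z) lz') (is_diff_cst c0 z).
  rewrite !fctE subr0.
  have [b b0 bE] := chart_diff_foliation az.
  have H := congr1 (fun f => chart_eval j f z) (TE i l).
  rewrite /chart_eval !mevalM in H.
  exact: proportional_quotient b0 (bE e _ (hT i)) (bE e _ (hT l)) H.
Qed.

End Assembly.

(** From extended reals to natural numbers. If there are infinitely many hypersurfaces, k m + c + 1
    of them suffice because k > 0. *)
Lemma many_invariant_hypersurfaces (R : realType) (n k c m : nat) (F : foliation
  R n) :
  (0 < k)%N -> (m%:R%:E < num_invariant F k)%E ->
  (c%:R%:E / (num_invariant F k - m%:R%:E) < k%:R%:E)%E ->
  exists s : seq (set (proj_space R n)), [/\ uniq s,
    forall H, H \in s -> invariant_hypersurfaces F k H & (k * m + c < size s *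
      k)%N].
Proof.
move=> k0; set S := invariant_hypersurfaces F k.
have [fS|iS] := pselect (finite_set S); last first.
  move=> _ _; have [B BS hB] := infinite_set_fset (k * m + c).+1 iS.
  exists (enum_fset B); split; first exact: fset_uniq.
    by move=> H HB; apply: BS.
  by apply: leq_trans hB _; rewrite leq_pmulr.
have -> : num_invariant F k = (size (enum_fset (fset_set S)))%:R%:E.
  by rewrite /num_invariant /counting asboolT.
set N := size _; rewrite lte_fin ltr_nat => mN.
have NM0 : (N%:R - m%:R : R) != 0 by rewrite subr_eq0 eqr_nat gtn_eqF.
rewrite -EFinB inver (negbTE NM0) -EFinM lte_fin ltr_pdivrMr ?subr_gt0 ?ltr_nat //.
rewrite -natrB ?(ltnW mN) // -natrM ltr_nat => h.
exists (enum_fset (fset_set S)); split; first exact: fset_uniq.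
  by move=> H; rewrite in_fset_set // => /set_mem.
rewrite -[size _]/N; move: h; rewrite mulnBr => h.
have : (k * m <= k * N)%N by rewrite leq_mul2l (ltnW mN) orbT.
lia.
Qed.

Theorem corollary1p2 (R : realType) (n d k : nat) (F : foliation R n)
    (hd : (2 <= d)%N) (hF : fol_degree F d)
    (hN : ('C(n + k, k)%:R%:E < num_invariant F k)%E)
    (hk : exists H : set (proj_space R n), invariant_hypersurfaces F k H /\
      (((d - 1) * 'C('C(n + k, k), 2))%N%:R%:E
         / (num_invariant F k - 'C(n + k, k)%:R%:E) < k%:R%:E)%E) :
  has_rational_first_integral F.
Proof.
(* From here on [d] is the degree of the foliation minus one. *)
case: d hd hF hk => [//|d] _ hF [H0 [[f0 [f0k f0i _ _]]]]; rewrite subn1 /= => hk.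
(* The given hypersurface has an irreducible equation, whereas a form of degree 0 is zero or a
   unit. *)
have k0 : (0 < k)%N.
  rewrite lt0n; apply/eqP => k0; move: f0k; rewrite k0 => /homog0_const E.
  have [f00 /negP[]] := f0i; apply: mpoly_unit_const => //.
  by rewrite E msizeC; case: (_ != _).
have [s [us sS lt_s]] := many_invariant_hypersurfaces k0 hN hk.
have [Xv [Xv_homog XvP]] := homogeneous_vector_field hF.
have /choice[f hf] : forall i : 'I_(size s), exists f : mpoly n.+1 (Cx R),
    [/\ is_form k f, irreducible_elt f, nth set0 s i = zeros f &
      forall j, invariant_locus F (affine j)
        (fun (_ : 'I_1) p => form_at f p / hcoord p 0 j ^+ k)].
  by move=> i; have [f hf] := sS _ (mem_nth set0 (ltn_ord i)); exists f.
(* If one irreducible form divided another, the quotient would be a unit and the two zero sets would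
   coincide. *)
have fij i j : i != j -> ~ divides (f i) (f j).
  move=> ij [q E]; case/negP: ij; rewrite -val_eqE /= -(nth_uniq set0 _ _ us) //.
  have [_ [_ fiu _] -> _] := hf i; have [_ [_ _ fjU] -> _] := hf j.
  have [qu|/negP//] := fjU _ _ E; last by rewrite (negbTE fiu).
  apply/eqP/seteqP; rewrite /zeros /form_at E.
  have q0 p : meval (fun l => hcoord p 0 l) q != 0.
    by rewrite -unitfE; exact: rmorph_unit.
  split=> p /= h; first by rewrite mevalM h mulr0.
  by move/eqP: h; rewrite mevalM mulf_eq0 (negbTE (q0 p)) => /eqP.
pose ms := [seq s2m (val t) | t <- enum (basis n.+1 k)].
have [e [p [q [hp hq q0 npq XE]]]] :=
  @first_integral_of_invariant_forms _ _ Xv d Xv_homog k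
  'C(n + k, k) (size s) ms f (uniq_basis n.+1 k)
  (etrans (size_basis n k) (congr1 (fun m => 'C(m, k)) (addnC k n)))
  (@basis_cover n.+1 k) (fun i => let: And4 h _ _ _ := hf i in h)
  (fun i => let: And4 _ h _ _ := hf i in h) fij
  (fun i => let: And4 h1 h2 _ h3 :=
    hf i in invariant_form_divides Xv_homog XvP h1 h2 k0 h3)
  (ltac:(by rewrite bin_gt0 leq_addl)) lt_s.
exact: rational_first_integral_of_forms XvP _ _ _ hp hq q0 npq XE.
Qed.
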